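(* Let $B=(B_t)_{t\ge 0}$ be a standard one-dimensional Brownian motion with $B_0=0$. For $x\in\mathbb{R}$ and $\delta\in(-\infty,0]$ let $\zeta_\delta^x$ be the first time at which the Bessel process of dimension $\delta$ started from $x$ and driven by $B$ hits $0$ (with $\zeta_\delta^0=0$), all these processes being driven by the same Brownian motion $B$. Then, almost surely, the function $(x,\delta)\mapsto \zeta_\delta^x$ is jointly continuous in $x\in\mathbb{R}$ and $\delta\le 0$.
   Context: For $\delta\in\mathbb{R}$ and $x\in\mathbb{R}\setminus\{0\}$, the Bessel process of dimension $\delta$ started from $x$ and driven by $B$ is the solution $Z_t=Z_t^{\delta}(x)$ of $$dZ_t=dB_t+\frac{\delta-1}{2}\,\frac{1}{Z_t}\,dt,\qquad Z_0=x,$$ considered up to its first hitting time of $0$. Since the noise is additive, for each fixed path of $B$ the equation is understood pathwise, as the integral equation $Z_t=x+B_t+\frac{\delta-1}{2}\int_0^t\frac{dr}{Z_r}$, which has a unique solution up to the hitting time of $0$; thus the solutions for all $x\neq 0$ and all $\delta$ are defined simultaneously from the same path $B$. The hitting time is $\zeta_\delta^x:=\inf\{t>0 : Z_t^{\delta}(x)=0\}$ for $x\ne 0$, and $\zeta_\delta^0:=0$. *)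

(* Defs.v *)
From mathcomp Require Import all_boot all_order all_algebra.
From mathcomp Require Import all_classical all_reals all_analysis.

Set Implicit Arguments.
Unset Strict Implicit.
Unset Printing Implicit Defensive.

Import Order.TTheory GRing.Theory Num.Theory.
Import numFieldNormedType.Exports.

Local Open Scope classical_set_scope.
Local Open Scope ring_scope.

Definition mutually_independent (R : realType) (d : measure_display)
    (T : measurableType d) (P : probability T R) (n : nat)
    (X : 'I_n -> T -> R) : Prop :=
  forall A : 'I_n -> set R, (forall i, measurable (A i)) ->
    P (\bigcap_(i in [set: 'I_n]) (X i @^-1` A i)) =
    (\prod_(i < n) P (X i @^-1` A i))%E.

(* Time is indexed by all of R, but only the times t >= 0 are constrained.
   The second argument of normal_prob is the standard deviation. *)
Record brownian_motion (R : realType) (d : measure_display)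
    (T : measurableType d) (P : probability T R) (B : R -> {RV P >-> R}) :
    Prop := BrownianMotion {
  bm_start : {ae P, forall w, B 0 w = 0} ;
  bm_independent : forall (n : nat) (t : nat -> R),
    0 <= t 0%N -> (forall i, t i <= t i.+1) ->
    mutually_independent P
      (fun (i : 'I_n) (w : T) => B (t i.+1) w - B (t i) w) ;
  bm_gaussian : forall s t : R, 0 <= s -> s < t ->
    forall A : set R, measurable A ->
      P ((fun w => B t w - B s w) @^-1` A) =
      normal_prob 0 (Num.sqrt (t - s)) A ;
  bm_continuous :
    {ae P, forall w, {within [set t | 0 <= t], continuous (fun t => B t w)}}
}.

(* Equal to +oo if z has no zero at positive times. *)
Definition hitting_time0 (R : realType) (z : R -> R) : \bar R :=
  ereal_inf [set t%:E | t in [set t | 0 < t /\ z t = 0]].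

(* z is the solution started from x <> 0 and driven by the path b. The equation
   is required strictly before the hitting time of 0; from that time on z is
   frozen at 0. Continuity on all of [0, +oo[ then forces z to reach 0 at its
   hitting time. *)
Definition is_bessel (R : realType) (b : R -> R) (delta x : R) (z : R -> R) :
    Prop :=
  [/\ {within [set t | 0 <= t], continuous z},
      z 0 = x,
      (forall t, 0 <= t -> (t%:E < hitting_time0 z)%E ->
         z t = x + b t +
           (delta - 1) / 2 *
           \int[lebesgue_measure]_(r in `[0, t]) (z r)^-1) &
      (forall t, (hitting_time0 z <= t%:E)%E -> z t = 0)].

(* The solution is unique on [0, +oo[ when b is continuous there with b 0 = 0,
   which makes this choice canonical. *)
Definition bessel (R : realType) (b : R -> R) (delta x : R) : R -> R :=
  xget (cst 0) [set z | is_bessel b delta x z].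

Definition zeta (R : realType) (b : R -> R) (delta x : R) : \bar R :=
  if x == 0 then 0%E else hitting_time0 (bessel b delta x).

(* Main.v *)
From HB Require Import structures.
Require Import Defs.
From mathcomp Require Import all_boot all_order all_algebra.
From mathcomp Require Import all_classical all_reals all_analysis.
From mathcomp Require Import measurable_realfun.
From mathcomp Require Import ring lra.

(** A solution started from [x > 0] with [delta <= 0] is pushed towards zero by
  the drift [- c / Z], where [c = (1 - delta) / 2 >= 1 / 2]; negative starting
  points reduce to positive ones by changing the sign of the path. As long as a
  solution stays positive the equation has Lipschitz coefficients, so solutions
  depend continuously on [(x, delta)] up to the hitting time of zero
  ([solution_stability]). This gives lower semicontinuity of the hitting time
  for every continuous path.

  Upper semicontinuity can only fail as follows: solutions with parameters close
  to [(x, delta)] come very close to zero near the hitting time of the limiting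
  one and still survive for a macroscopic time. Look at such a survivor from a
  later time [T] at which it has height at least [y], and run time backwards.
  The reversed process solves [V = y + W + c int 1 / V], where [W] is the
  reversed path; it is a Bessel process of dimension [2 c + 1 = 2 - delta >= 2],
  which almost surely never comes back to zero. By comparison the case
  [c = 1 / 2] of dimension 2 suffices, and countably many pairs [(T, y)] suffice
  too. Hence almost surely, for all these pairs and simultaneously for all [c]
  in a bounded subinterval of [1 / 2, +oo[, survivors keep a positive distance
  from zero ([repelling], [survivors_stay_away]), and the bad scenario is
  excluded. The same argument with [x] close to zero gives continuity at
  [x = 0]. All this is deterministic and ends with [zeta_continuous].

  The probabilistic statement [ae_repelling] is proved in discrete time. Over a
  mesh of size [h], an Euler chain driven by the reversed increments of the path
  stays below every reversed solution until it drops below a level [rho]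
  ([euler_chain_comparison]). For a Bessel process of dimension 2, [- ln] is a
  local martingale; correspondingly [x ^+ 2 - ln (max x (rho / 2))] grows by at
  most [4 h] in mean at each step of the chain ([euler_step_lyapunov]). Its
  value is at least [- ln rho] below [rho], so the chain drops below [rho]
  before time [T] with probability at most a constant over [- ln rho], uniformly
  in small [h] ([reversed_chain_frozen_prob]). Letting [h], then [rho], tend to
  zero shows that almost surely no reversed solution reaches zero
  ([ae_stays_away]).

  The solution which the definition of [bessel] selects exists by a monotone
  Picard iteration for the equation with drift [- c / max (Z, e)]: since this
  drift is nondecreasing in [Z], the iterates decrease to a maximal solution,
  and the maximal solutions for different [e] agree while they stay above [e]
  ([bessel_exists]). *)

Set Implicit Arguments.
Unset Strict Implicit.
Unset Printing Implicit Defensive.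

Import Order.TTheory GRing.Theory Num.Theory.
Import numFieldNormedType.Exports.

Local Open Scope classical_set_scope.
Local Open Scope ring_scope.

(** * Integrals over segments and first zeros *)

Section SegmentIntegrals.
Variable R : realType.
Notation mu := (@lebesgue_measure R).

Lemma within_segment_eps (f : R -> R) (s t : R) :
  {within `[s, t], continuous f} <->
  (forall u, s <= u <= t -> forall e, 0 < e -> exists2 d, 0 < d &
    forall r, s <= r <= t -> `|r - u| < d -> `|f r - f u| < e).
Proof.
split=> [/subspace_continuousP cf u ut e e0|H].
  have /cf/cvgrPdist_lt/(_ _ e0) : `[s, t]%classic u by rewrite /= in_itv.
  rewrite /prop_near1/= nbhs_filterE /within/= => -[d/= d0 hd].
  exists d => // r rt rd; rewrite distrC; apply: hd => /=.
    by rewrite distrC.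
  by rewrite in_itv.
apply/subspace_continuousP => u; rewrite /= in_itv/= => ut.
apply/cvgrPdist_lt => e e0; have [d d0 hd] := H u ut e e0.
rewrite /prop_near1/= nbhs_filterE /within/=; exists d => //= r rd.
rewrite in_itv/= => rt; rewrite distrC; apply: hd => //.
by rewrite distrC.
Qed.

Lemma within_ray_eps (f : R -> R) :
  {within [set t | 0 <= t], continuous f} <->
  (forall u, 0 <= u -> forall e, 0 < e -> exists2 d, 0 < d &
    forall r, 0 <= r -> `|r - u| < d -> `|f r - f u| < e).
Proof.
split=> [/subspace_continuousP cf u ut e e0|H].
  have /cf/cvgrPdist_lt/(_ _ e0) : [set t | 0 <= t] u by [].
  rewrite /prop_near1/= nbhs_filterE /within/= => -[d/= d0 hd].
  exists d => // r rt rd; rewrite distrC; apply: hd => //=.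
  by rewrite distrC.
apply/subspace_continuousP => u/= ut.
apply/cvgrPdist_lt => e e0; have [d d0 hd] := H u ut e e0.
rewrite /prop_near1/= nbhs_filterE /within/=; exists d => //= r rd rt.
by rewrite distrC; apply: hd => //; rewrite distrC.
Qed.

Lemma within_ray_segment (f : R -> R) (s t : R) : 0 <= s ->
  {within [set t | 0 <= t], continuous f} -> {within `[s, t], continuous f}.
Proof.
move=> s0; apply: continuous_subspaceW => r /=; rewrite in_itv/= => /andP[sr _].
exact: le_trans sr.
Qed.

Lemma within_segmentS (f : R -> R) (s t s' t' : R) : s' <= s -> t <= t' ->
  {within `[s', t'], continuous f} -> {within `[s, t], continuous f}.
Proof.
move=> ss tt; apply: continuous_subspaceW => r /=; rewrite !in_itv/=.
by move=> /andP[sr rt]; rewrite (le_trans ss sr) (le_trans rt tt).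
Qed.

Lemma segment_integrable (f : R -> R) (s t : R) :
  {within `[s, t], continuous f} -> mu.-integrable `[s, t] (EFin \o f).
Proof. exact: continuous_compact_integrable (@segment_compact _ s t). Qed.

Lemma within_inv (z : R -> R) (s t : R) :
  {within `[s, t], continuous z} -> (forall r, s <= r <= t -> 0 < z r) ->
  {within `[s, t], continuous (fun r => (z r)^-1)}.
Proof.
move=> /subspace_continuousP cz z0; apply/subspace_continuousP => u us.
apply: cvgV; last exact: cz.
by rewrite gt_eqF// z0//; move: us; rewrite /= in_itv.
Qed.

Lemma integrable_EFinZ (f : R -> R) (k s t : R) :
  mu.-integrable `[s, t] (EFin \o f) ->
  mu.-integrable `[s, t] (EFin \o (fun r => k * f r)).
Proof. by move=> fi; exact: (integrableZl _ k fi). Qed.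

Lemma integrable_EFinD (f g : R -> R) (s t : R) :
  mu.-integrable `[s, t] (EFin \o f) -> mu.-integrable `[s, t] (EFin \o g) ->
  mu.-integrable `[s, t] (EFin \o (fun r => f r + g r)).
Proof. by move=> fi gi; exact: (integrableD _ fi gi). Qed.

Lemma integrable_EFinB (f g : R -> R) (s t : R) :
  mu.-integrable `[s, t] (EFin \o f) -> mu.-integrable `[s, t] (EFin \o g) ->
  mu.-integrable `[s, t] (EFin \o (fun r => f r - g r)).
Proof. by move=> fi gi; exact: (integrableB _ fi gi). Qed.

Lemma Rintegral_segment_split (f : R -> R) (s t u : R) : s <= t -> t <= u ->
  mu.-integrable `[s, u] (EFin \o f) ->
  \int[mu]_(r in `[s, u]) f r =
  \int[mu]_(r in `[s, t]) f r + \int[mu]_(r in `[t, u]) f r.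
Proof.
move=> st tu fi; apply/eqP; rewrite addrC -subr_eq; apply/eqP.
rewrite Rintegral_itvB ?bnd_simp//; apply: Rintegral_itv_obnd_cbnd.
apply: integrableS fi => //; apply: subset_itvr; first by rewrite bnd_simp.
Qed.

Lemma Rintegral_segment_cst (k s t : R) : s <= t ->
  \int[mu]_(r in `[s, t]) (fun=> k) r = k * (t - s).
Proof.
move=> st; rewrite Rintegral_cst; last exact: measurable_itv.
rewrite [X in fine X](lebesgue_measure_itv `[s, t]%R)/= lte_fin.
by case: ltP => //= ts; rewrite (_ : s = t) ?subrr//; apply/eqP; rewrite eq_le st.
Qed.

Lemma Rintegral_segment_ge (f : R -> R) (m s t : R) : s <= t ->
  mu.-integrable `[s, t] (EFin \o f) -> (forall r, s <= r <= t -> m <= f r) ->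
  m * (t - s) <= \int[mu]_(r in `[s, t]) f r.
Proof.
move=> st fi mf; rewrite -Rintegral_segment_cst//; apply: le_Rintegral => //.
by apply: segment_integrable; apply: continuous_subspaceT => ?; exact: cvg_cst.
Qed.

Lemma Rintegral_segment_le (f : R -> R) (m s t : R) : s <= t ->
  mu.-integrable `[s, t] (EFin \o f) -> (forall r, s <= r <= t -> f r <= m) ->
  \int[mu]_(r in `[s, t]) f r <= m * (t - s).
Proof.
move=> st fi mf; rewrite -Rintegral_segment_cst//; apply: le_Rintegral => //.
by apply: segment_integrable; apply: continuous_subspaceT => ?; exact: cvg_cst.
Qed.

Lemma Rintegral_segment_abs_le (f g : R -> R) (s t : R) :
  mu.-integrable `[s, t] (EFin \o f) -> mu.-integrable `[s, t] (EFin \o g) ->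
  (forall r, s <= r <= t -> `|f r| <= g r) ->
  `|\int[mu]_(r in `[s, t]) f r| <= \int[mu]_(r in `[s, t]) g r.
Proof.
move=> fi gi fg; apply: le_trans (le_normr_Rintegral _ fi) _ => //.
by apply: le_Rintegral => //; exact: (integrable_norm fi).
Qed.

Lemma Rintegral_expR (k a t : R) : 0 <= t ->
  \int[mu]_(r in `[0, t]) (k * (a * expR (k * r))) = a * expR (k * t) - a.
Proof.
rewrite le_eqVlt => /predU1P[<-|t0].
  by rewrite set_itv1 Rintegral_set1 mulr0 expR0 mulr1 subrr.
have dF (x : R) : is_derive x (1 : R) (fun r : R => a * expR (k * r)) (k * (a * expR (k * x))).
  by apply: is_derive_eq; rewrite /GRing.scale/=; ring.
have cF : continuous (fun r : R => a * expR (k * r)).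
  by move=> x; apply: differentiable_continuous; apply/derivable1_diffP.
rewrite /Rintegral (@continuous_FTC2 _ _ (fun r : R => a * expR (k * r)))//.
- by rewrite mulr0 expR0 mulr1.
- by apply: continuous_subspaceT => x; apply: cvgM; [exact: cvg_cst|exact: cF].
- split=> //; first by apply: cvg_at_right_filter; exact: cF.
  by apply: cvg_at_left_filter; exact: cF.
- by move=> x _; rewrite derive1E derive_val.
Qed.

(** The point [t1] is the infimum of the times at which [g] is nonnegative. *)
Lemma first_zero (g : R -> R) (s t : R) : {within `[0, s], continuous g} ->
  g 0 < 0 -> 0 <= t <= s -> 0 <= g t ->
  exists t1, [/\ 0 < t1, t1 <= t, g t1 = 0 & forall r, 0 <= r < t1 -> g r < 0].
Proof.
move=> /within_segment_eps cg g0 /andP[t0 ts] gt.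
pose S := [set r | 0 <= r <= s /\ 0 <= g r].
have St : S t by split => //; rewrite t0.
have lbS : lbound S 0 by move=> r [/andP[]].
have hS : has_inf S by split; [exists t|exists 0].
have t1t : inf S <= t by apply: ge_inf => //; case: hS.
have t10 : 0 <= inf S by apply: lb_le_inf => //; case: hS.
have ht1 : 0 <= inf S <= s by rewrite t10 (le_trans t1t).
have lt1 r : 0 <= r < inf S -> g r < 0.
  move=> /andP[r0 rS]; rewrite ltNge; apply/negP => gr.
  have : S r by split=> //; rewrite r0/= (le_trans (ltW rS))// (le_trans t1t).
  by move/(ge_inf hS.2); rewrite leNgt rS.
have gt1 : 0 <= g (inf S).
  rewrite leNgt; apply/negP => gn.
  have [d d0 hd] := cg _ ht1 (- g (inf S)) (ltac:(by rewrite oppr_gt0)).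
  have [u [/andP[u0 us] gu] ud] := inf_adherent d0 hS.
  have : `|g u - g (inf S)| < - g (inf S).
    apply: hd; first by rewrite u0.
    rewrite ger0_norm ?subr_ge0; first by rewrite ltrBlDl.
    by apply: ge_inf => //; [case: hS|split=> //; rewrite u0].
  by rewrite ltr_norml => /andP[_]; lra.
have t1p : 0 < inf S.
  rewrite lt_neqAle t10 andbT; apply/eqP => t1E.
  by move: gt1; rewrite -t1E leNgt g0.
exists (inf S); split => //; apply/eqP; rewrite eq_le gt1 andbT leNgt.
apply/negP => gp; have [d d0 hd] := cg _ ht1 _ gp.
pose r := Num.max (inf S / 2) (inf S - d / 2).
have rS : 0 <= r < inf S.
  by rewrite /r le_max gt_max; apply/andP; split; [|apply/andP; split]; lra.
have : `|g r - g (inf S)| < g (inf S).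
  apply: hd; first by case/andP: ht1 => _ ?; case/andP: rS => -> /ltW /le_trans->.
  have : inf S - d / 2 <= r by rewrite /r le_max lexx orbT.
  by move=> rd; case/andP: rS => _ rS; rewrite ltr0_norm ?subr_lt0//; lra.
by have := lt1 _ rS; rewrite ltr_norml => ? /andP[]; lra.
Qed.

End SegmentIntegrals.

(** * Positive solutions and their stability *)

Section PositiveSolutions.
Variable R : realType.
Notation mu := (@lebesgue_measure R).
Implicit Types (b z : R -> R) (c x s t : R).

(** [t] is strictly before the hitting time of zero, so the equation holds
  without the convention that freezes solutions at zero. *)
Definition positive_solution b c x z t :=
  [/\ {within `[0, t], continuous z},
      (forall s, 0 <= s <= t -> 0 < z s) &
      (forall s, 0 <= s <= t ->
         z s = x + b s - c * \int[mu]_(r in `[0, s]) (z r)^-1)].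

Lemma positive_solution_int b c x z t : positive_solution b c x z t ->
  mu.-integrable `[0, t] (EFin \o (fun r => (z r)^-1)).
Proof. by move=> [cz z0 _]; apply: segment_integrable; exact: within_inv. Qed.

Lemma positive_solution_intS b c x z t u v : positive_solution b c x z t ->
  0 <= u -> v <= t -> mu.-integrable `[u, v] (EFin \o (fun r => (z r)^-1)).
Proof.
move=> [cz z0 _] u0 vt; apply: segment_integrable; apply: within_inv.
  exact: within_segmentS cz.
by move=> r /andP[ur rv]; rewrite z0// (le_trans u0 ur) (le_trans rv vt).
Qed.

Lemma positive_solutionS b c x z s t : s <= t ->
  positive_solution b c x z t -> positive_solution b c x z s.
Proof.
move=> st [cz z0 ze]; split.
- exact: within_segmentS cz.
- by move=> r /andP[r0 rs]; rewrite z0// r0 (le_trans rs).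
- by move=> r /andP[r0 rs]; rewrite -ze// r0 (le_trans rs).
Qed.

Lemma positive_solution_incr b c x z t u v : positive_solution b c x z t ->
  0 <= u -> u <= v -> v <= t ->
  z v - z u = b v - b u - c * \int[mu]_(r in `[u, v]) (z r)^-1.
Proof.
move=> pz u0 uv vt; have [_ _ ze] := pz.
rewrite (ze v) ?(ze u) ?u0 ?(le_trans u0 uv) ?(le_trans uv vt)//.
rewrite (@Rintegral_segment_split _ _ 0 u v)//; last exact: (positive_solution_intS pz).
ring.
Qed.

Lemma hitting_time0_le z t : 0 < t -> z t = 0 -> (hitting_time0 z <= t%:E)%E.
Proof. by move=> t0 zt; apply: ereal_inf_lbound; exists t. Qed.

Lemma hitting_time0_ge0 z : (0 <= hitting_time0 z)%E.
Proof. by apply: le_ereal_inf_tmp => _ [t [t0 _] <-]; rewrite lee_fin ltW. Qed.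

Lemma within_opp (A : set R) z : {within A, continuous z} ->
  {within A, continuous (fun r => - z r)}.
Proof.
move=> /subspace_continuousP cz; apply/subspace_continuousP => u Au.
by apply: cvgN; exact: cz.
Qed.

Lemma bessel_positive_solution b delta x z t : 0 < x ->
  is_bessel b delta x z -> 0 <= t -> (t%:E < hitting_time0 z)%E ->
  positive_solution b ((1 - delta) / 2) x z t.
Proof.
move=> x0 [cz z0 ze _] t0 tz.
have czt : {within `[0, t], continuous z} by exact: within_ray_segment cz.
split => //.
  move=> s /andP[s0 st]; rewrite ltNge; apply/negP => zs.
  have [||||t1 [t10 t1s /eqP]] := @first_zero _ (fun r => - z r) t s.
  - exact: within_opp.
  - by rewrite z0 oppr_lt0.
  - by rewrite s0.
  - by rewrite oppr_ge0.
  rewrite oppr_eq0 => /eqP zt1 _.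
  have := hitting_time0_le t10 zt1; rewrite leNgt => /negP; apply.
  by apply: le_lt_trans tz; rewrite lee_fin (le_trans t1s).
move=> s /andP[s0 st]; rewrite ze//; first by field.
by apply: le_lt_trans tz; rewrite lee_fin.
Qed.

Lemma le_left_limit z t1 s m : {within `[0, s], continuous z} -> 0 < t1 <= s ->
  (forall r, 0 <= r < t1 -> m <= z r) -> m <= z t1.
Proof.
move=> /within_segment_eps cz /andP[t10 t1s] hm; rewrite leNgt; apply/negP => zm.
have [|d d0 hd] := cz t1 _ (m - z t1) (ltac:(by rewrite subr_gt0)).
  by rewrite (ltW t10).
pose r := Num.max 0 (t1 - d / 2).
have r0 : 0 <= r by rewrite /r le_max lexx.
have rt1 : r < t1 by rewrite /r gt_max t10/=; lra.
have : `|z r - z t1| < m - z t1.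
  apply: hd; first by rewrite r0 (le_trans (ltW rt1)).
  rewrite ltr0_norm ?subr_lt0//.
  by have : t1 - d / 2 <= r; [rewrite /r le_max lexx orbT|lra].
by rewrite ltr_norml => /andP[_]; have := hm r; rewrite r0 rt1 => /(_ isT); lra.
Qed.

(** A Gronwall estimate: the distance of the two solutions cannot reach the
  exponential barrier [psi], which stays below half the minimum of [z0], so that
  both equations remain Lipschitz. *)
Lemma solution_stability b delta0 x0 z0 s : 0 <= s -> delta0 <= 0 ->
  positive_solution b ((1 - delta0) / 2) x0 z0 s ->
  forall e, 0 < e -> exists2 th, 0 < th &
    forall delta x z, `|delta - delta0| < th -> `|x - x0| < th -> 0 < x ->
      is_bessel b delta x z ->
      (s%:E < hitting_time0 z)%E /\ `|z s - z0 s| < e.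
Proof.
move=> s0 d0 pz0 e e0; have [cz0 z00 z0e] := pz0.
have [a as_ am] := EVT_min s0 cz0.
set m := z0 a in am; have m0 : 0 < m by apply: z00; rewrite in_itv in as_.
set c0 := (1 - delta0) / 2 in pz0 z0e *.
have c00 : 0 < c0 by rewrite /c0; lra.
pose K := 2 * c0 / m ^+ 2.
have K0 : 0 < K by rewrite divr_gt0// ?exprn_gt0// mulr_gt0.
pose E := expR (K * s).
have E0 : 0 < E by exact: expR_gt0.
pose h := Num.min e (m / 2) / E / 2.
have h0 : 0 < h by rewrite !divr_gt0// lt_min e0 divr_gt0.
pose psi t := h * expR (K * t).
have psis t : t <= s -> psi t < Num.min e (m / 2).
  move=> ts; apply: (@le_lt_trans _ _ (h * E)).
    by rewrite ler_pM2l// ler_expR ler_pM2l.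
  rewrite /h mulrAC divfK ?gt_eqF//.
  have : 0 < Num.min e (m / 2) by rewrite lt_min e0 divr_gt0.
  lra.
pose th := h / (1 + 2 * s / m).
have D0 : 0 < 1 + 2 * s / m.
  by rewrite ltr_pwDl// divr_ge0 ?mulr_ge0// ltW.
have th0 : 0 < th by rewrite divr_gt0.
exists th => // delta x z dd xx x_gt0 bz.
have [czr z_0 ze zz] := bz.
have cz : {within `[0, s], continuous z} by exact: within_ray_segment czr.
pose c := (1 - delta) / 2.
have cc : `|c0 - c| <= th.
  have -> : c0 - c = (delta - delta0) / 2 by rewrite /c /c0; field.
  rewrite normrM [X in _ * X]ger0_norm ?invr_ge0// .
  by rewrite ler_pdivrMr// (le_trans (ltW dd))// ler_peMr ?ltW//; lra.
pose D t := `|z t - z0 t|.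
have alive t1 : 0 <= t1 <= s -> (forall r, 0 <= r < t1 -> D r < psi r) ->
    (t1%:E < hitting_time0 z)%E.
  move=> /andP[t10 t1s] Dpsi.
  have zm r : 0 <= r < t1 -> m / 2 <= z r.
    move=> rt; have := Dpsi _ rt; case/andP: rt => r0 rt.
    have rs : r <= s by rewrite (le_trans (ltW rt)).
    have := psis _ rs; rewrite lt_min => /andP[_ p1].
    have : m <= z0 r by apply: am; rewrite in_itv/= r0.
    by rewrite /D ltr_norml => ? /andP[]; lra.
  have [t1_eq0|t1_neq0] := eqVneq t1 0.
    rewrite t1_eq0 ltNge; apply/negP => hz.
    by move: (zz _ hz); rewrite z_0 => xE; rewrite xE ltxx in x_gt0.
  have t1p : 0 < t1 by rewrite lt_neqAle eq_sym t1_neq0.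
  rewrite ltNge; apply/negP => /zz zt1.
  have : m / 2 <= z t1 by apply: (@le_left_limit _ _ s) => //; rewrite t1p.
  by rewrite zt1; lra.
suff Dpsi r : 0 <= r <= s -> D r < psi r.
  split; first by apply: alive => [|r /andP[r0 rs]];
    [rewrite s0 lexx|apply: Dpsi; rewrite r0 ltW].
  apply: lt_trans (Dpsi _ _) _; first by rewrite s0 lexx.
  by have := psis _ (lexx s); rewrite lt_min => /andP[].
move=> /andP[r0 rs]; rewrite ltNge; apply/negP => rbad.
have cD : {within `[0, s], continuous (fun t => D t - psi t)}.
  move/subspace_continuousP : cz0 => cz0'; move/subspace_continuousP : cz => cz'.
  apply/subspace_continuousP => u us; apply: cvgB.
    by apply: cvg_norm; apply: cvgB; [exact: cz'|exact: cz0'].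
  apply: cvg_within_filter; apply: cvgM; first exact: cvg_cst.
  apply: continuous_cvg; first exact: continuous_expR.
  by apply: cvgM; [exact: cvg_cst|exact: cvg_id].
have z00x : z0 0 = x0 + b 0.
  by rewrite z0e ?lexx//= set_itv1 Rintegral_set1 mulr0 subr0.
have z0x : z 0 = x + b 0.
  rewrite ze//; first by rewrite set_itv1 Rintegral_set1 mulr0 addr0.
  by apply: alive; rewrite ?lexx// => ? /andP[/le_lt_trans/[apply]]; rewrite ltxx.
have thE : th + th * (2 * s / m) = h.
  by rewrite -[X in X + _]mulr1 -mulrDr /th divfK// gt_eqF.
have thh : th <= h.
  rewrite -thE lerDl; apply: mulr_ge0; first exact: ltW.
  by rewrite divr_ge0 ?mulr_ge0 ?(ltW m0).
have [||||t1 [t10 t1r /eqP]] := @first_zero _ (fun t => D t - psi t) s r.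
- exact: cD.
- rewrite /D /psi mulr0 expR0 mulr1 z00x z0x subr_lt0.
  by rewrite opprD addrACA subrr addr0 (lt_le_trans xx).
- by rewrite r0.
- by rewrite subr_ge0.
rewrite subr_eq0 => /eqP Dt1 Dlt.
have t1s : t1 <= s by exact: le_trans rs.
have lt1 u : 0 <= u < t1 -> D u < psi u by move/Dlt; rewrite subr_lt0.
have t1z : (t1%:E < hitting_time0 z)%E by apply: alive => //; rewrite ltW.
have pz : positive_solution b c x z t1.
  by apply: bessel_positive_solution => //; exact: ltW.
have pz01 := positive_solutionS t1s pz0.
have Dle u : 0 <= u <= t1 -> D u <= psi u.
  move=> /andP[u0]; rewrite le_eqVlt => /predU1P[->|ut]; first by rewrite Dt1.
  by rewrite ltW// lt1// u0.
have zm u : 0 <= u <= t1 -> m / 2 <= z u /\ m <= z0 u.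
  move=> ut; have := Dle _ ut; case/andP: ut => u0 ut.
  have us : u <= s by rewrite (le_trans ut).
  have := psis _ us; rewrite lt_min => /andP[_ p1].
  have : m <= z0 u by apply: am; rewrite in_itv/= u0.
  by rewrite /D ler_norml => ? /andP[]; split=> //; lra.
have i0 := positive_solution_int pz01; have i1 := positive_solution_int pz.
have cpsi : {within `[0, t1], continuous (fun r => K * (h * expR (K * r)))}.
  apply: continuous_subspaceT => u; apply: cvgM; first exact: cvg_cst.
  apply: cvgM; first exact: cvg_cst.
  apply: continuous_cvg; first exact: continuous_expR.
  by apply: cvgM; [exact: cvg_cst|exact: cvg_id].
have ccst (k : R) : {within `[0, t1], continuous (fun=> k)}.
  by apply: continuous_subspaceT => u; exact: cvg_cst.
have : D t1 <= `|x - x0| + (th * (2 * s / m) + (h * expR (K * t1) - h)).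
  have -> : D t1 = `|(x - x0) + \int[mu]_(r in `[0, t1])
                                  (c0 * (z0 r)^-1 - c * (z r)^-1)|.
    rewrite RintegralB//; last 2 first.
    - exact: integrable_EFinZ.
    - exact: integrable_EFinZ.
    rewrite !RintegralZl// /D.
    have [_ _ ->] := pz01; last by rewrite lexx ltW.
    have [_ _ ->] := pz; last by rewrite lexx ltW.
    by congr (`| _ |); ring.
  apply: le_trans (ler_normD _ _) _; rewrite lerD2l.
  apply: (@le_trans _ _ (\int[mu]_(r in `[0, t1])
      (th * (2 / m) + K * (h * expR (K * r))))).
    apply: Rintegral_segment_abs_le.
    - by apply: integrable_EFinB; exact: integrable_EFinZ.
    - by apply: integrable_EFinD; exact: segment_integrable.
    move=> u ut; have [zu z0u] := zm _ ut.
    have zp : 0 < z u by lra.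
    have z0p : 0 < z0 u by lra.
    have -> : c0 / z0 u - c / z u =
      (c0 - c) / z u + c0 * (z u - z0 u) / (z0 u * z u).
      by field; rewrite !gt_eqF.
    apply: le_trans (ler_normD _ _) _; apply: lerD.
      rewrite normrM; apply: ler_pM => //.
      rewrite gtr0_norm ?invr_gt0// -[2 / m]invf_div lef_pV2// ?posrE//.
      by rewrite divr_gt0.
    have P0 : 0 < c0 / (z0 u * z u) by rewrite divr_gt0// mulr_gt0.
    rewrite mulrAC normrM (gtr0_norm P0) -/(D u).
    apply: (@le_trans _ _ (c0 / (z0 u * z u) * (h * expR (K * u)))).
      by rewrite ler_pM2l//; exact: Dle.
    rewrite (ler_pM2r (mulr_gt0 h0 (expR_gt0 _))).
    have -> : K = c0 / (m * (m / 2)) by rewrite /K; field; rewrite gt_eqF.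
    rewrite ler_pM2l// lef_pV2 ?posrE ?mulr_gt0 ?divr_gt0//.
    by apply: ler_pM => //; rewrite ?ltW ?divr_gt0.
  rewrite RintegralD//; last 2 first.
  - exact: segment_integrable.
  - exact: segment_integrable.
  rewrite Rintegral_expR ?(ltW t10)// lerD2r Rintegral_segment_cst ?(ltW t10)//.
  rewrite subr0 -(mulrA th) (ler_pM2l th0).
  have -> : 2 * s / m = 2 / m * s by field; rewrite gt_eqF.
  by rewrite ler_pM2l// divr_gt0.
by rewrite Dt1 /psi; lra.
Qed.

End PositiveSolutions.

(** * Maximal solutions of the truncated equation *)

Section Existence.
Variables (R : realType) (b : R -> R) (c x : R).
Hypotheses (cb : {within [set t | 0 <= t], continuous b}) (c0 : 0 <= c).
Notation mu := (@lebesgue_measure R).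
Implicit Types (v g : R -> R) (e s t : R).

Lemma primitive_lipschitz g M s t : mu.-integrable `[0, t] (EFin \o g) ->
  (forall r, 0 <= r -> 0 <= g r <= M) -> 0 <= s -> s <= t ->
  0 <= \int[mu]_(r in `[0, t]) g r - \int[mu]_(r in `[0, s]) g r <= M * (t - s).
Proof.
move=> gi gM s0 st.
rewrite (Rintegral_segment_split s0 st gi) addrAC subrr add0r.
apply/andP; split.
  apply: Rintegral_ge0 => r; rewrite /= in_itv/= => /andP[sr _].
  by case/andP: (gM r (le_trans s0 sr)).
apply: Rintegral_segment_le => //.
  by apply: integrableS gi => //; apply: subset_itvr; rewrite bnd_simp.
by move=> r /andP[sr _]; case/andP: (gM r (le_trans s0 sr)).
Qed.

Lemma primitive_continuous g M :
  (forall t, 0 <= t -> mu.-integrable `[0, t] (EFin \o g)) ->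
  (forall r, 0 <= r -> 0 <= g r <= M) ->
  {within [set t | 0 <= t], continuous (fun t => \int[mu]_(r in `[0, t]) g r)}.
Proof.
move=> gi gM; apply/within_ray_eps => u u0 e e0.
have M0 : 0 <= M by case/andP: (gM 0 (lexx _)) => /le_trans; apply.
have M1 : 0 < M + 1 by lra.
exists (e / (M + 1)); first by rewrite divr_gt0.
move=> r r0 ru; apply: (@le_lt_trans _ _ (M * `|r - u|)); last first.
  apply: (@le_lt_trans _ _ ((M + 1) * `|r - u|)).
    by rewrite ler_wpM2r// lerDl.
  by rewrite mulrC -ltr_pdivlMr.
have [ur|ru'] := leP u r.
  have /andP[p1 p2] := primitive_lipschitz (gi _ r0) gM u0 ur.
  by rewrite (ger0_norm p1) ger0_norm// subr_ge0.
have /andP[p1 p2] := primitive_lipschitz (gi _ u0) gM r0 (ltW ru').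
by rewrite distrC (ger0_norm p1) distrC ger0_norm// subr_ge0 ltW.
Qed.

Lemma cvg_maxr (T : Type) (F : set_system T) (f : T -> R) (l e : R) :
  Filter F -> f @ F --> l -> Num.max (f t) e @[t --> F] --> Num.max l e.
Proof.
move=> FF /cvgrPdist_lt fl; apply/cvgrPdist_lt => a a0.
apply: filterS (fl _ a0) => t; apply: le_lt_trans.
have h1 := ler_norm (l - f t); have h2 := ler_norm (- (l - f t)).
have h3 := normr_ge0 (l - f t); rewrite normrN in h2; rewrite ler_norml /Num.max.
by case: ltP => ?; case: ltP => ?; apply/andP; split; lra.
Qed.

Definition truncated_drift e v r := (Num.max (v r) e)^-1.

Lemma truncated_drift_bound e v r : 0 < e -> 0 <= truncated_drift e v r <= e^-1.
Proof.
move=> e0; have m0 : 0 < Num.max (v r) e by rewrite lt_max e0 orbT.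
by rewrite invr_ge0 (ltW m0)/= lef_pV2 ?posrE// le_max lexx orbT.
Qed.

Lemma truncated_drift_int e v t : 0 < e -> {within `[0, t], continuous v} ->
  mu.-integrable `[0, t] (EFin \o truncated_drift e v).
Proof.
move=> e0 /subspace_continuousP cv; apply: segment_integrable.
apply: within_inv => [|r _]; last by rewrite lt_max e0 orbT.
apply/subspace_continuousP => u us; apply: cvg_maxr; exact: cv.
Qed.

(** Iterating from [x + b], which dominates every solution since the drift is
  nonpositive, yields a decreasing sequence. *)
Fixpoint picard e k : R -> R :=
  if k is k'.+1 then
    fun t => x + b t - c * \int[mu]_(r in `[0, t]) truncated_drift e (picard e k') r
  else fun t => x + b t.

Lemma ray_shift g : {within [set t | 0 <= t], continuous g} ->
  {within [set t | 0 <= t], continuous (fun t => x + b t - c * g t)}.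
Proof.
move=> /subspace_continuousP cg; move/subspace_continuousP : cb => cb'.
apply/subspace_continuousP => u u0; apply: cvgB.
  by apply: cvgD; [exact: cvg_cst|exact: cb'].
by apply: cvgM; [exact: cvg_cst|exact: cg].
Qed.

Lemma picard_continuous e k : 0 < e ->
  {within [set t | 0 <= t], continuous (picard e k)}.
Proof.
move=> e0; elim: k => [|k IHk] /=.
  move/subspace_continuousP : cb => cb'.
  apply/subspace_continuousP => u u0.
  by apply: cvgD; [exact: cvg_cst|exact: cb'].
apply: ray_shift; apply: (@primitive_continuous _ e^-1) => [t t0|r _].
  apply: truncated_drift_int => //; exact: within_ray_segment IHk.
exact: truncated_drift_bound.
Qed.

Lemma truncated_drift_le e e' v v' r : 0 < e -> e <= e' -> v r <= v' r ->
  truncated_drift e' v' r <= truncated_drift e v r.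
Proof.
move=> e0 ee vv; rewrite lef_pV2 ?posrE ?lt_max ?e0 ?(lt_le_trans e0 ee) ?orbT//.
by rewrite ge_max !le_max vv ee orbT.
Qed.

Lemma picard_nonincreasing e t : 0 < e -> 0 <= t ->
  nonincreasing_seq (fun k => picard e k t).
Proof.
move=> e0 t0; apply/nonincreasing_seqP => k.
elim: k t t0 => [|k IHk] t t0.
  rewrite /= gerBl mulr_ge0// Rintegral_ge0// => r _.
  by case/andP: (truncated_drift_bound (picard e 0) r e0).
have int n : mu.-integrable `[0, t] (EFin \o truncated_drift e (picard e n)).
  apply: truncated_drift_int => //; apply: within_ray_segment => //.
  exact: picard_continuous.
rewrite /= lerD2l lerN2 ler_wpM2l//; apply: le_Rintegral => //.
  exact: (int k.+1).
move=> r; rewrite /= in_itv/= => /andP[r0 rt].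
by apply: truncated_drift_le => //; exact: IHk.
Qed.

Lemma picard_lb e k t : 0 < e -> 0 <= t -> x + b t - c * (e^-1 * t) <= picard e k t.
Proof.
move=> e0 t0; case: k => [|k] /=.
  by rewrite gerBl mulr_ge0// mulr_ge0// invr_ge0 ltW.
rewrite lerD2l lerN2 ler_wpM2l// -[X in _ * X]subr0.
apply: Rintegral_segment_le => //.
  apply: truncated_drift_int => //; apply: within_ray_segment => //.
  exact: picard_continuous.
by move=> r _; case/andP: (truncated_drift_bound (picard e k) r e0).
Qed.

Definition truncated_solution e t := limn (fun k => picard e k t).
Local Notation U := truncated_solution.

Lemma picard_cvg e t : 0 < e -> 0 <= t -> picard e k t @[k --> \oo] --> U e t.
Proof.
move=> e0 t0; apply: nonincreasing_is_cvgn; first exact: picard_nonincreasing.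
by exists (x + b t - c * (e^-1 * t)) => _ [k _ <-]; exact: picard_lb.
Qed.

(** The truncated drifts of the iterates lie between 0 and [e^-1], so dominated
  convergence passes to the limit in the integral equation. *)
Lemma truncated_solution_eq e t : 0 < e -> 0 <= t ->
  mu.-integrable `[0, t] (EFin \o truncated_drift e (U e)) /\
  U e t = x + b t - c * \int[mu]_(r in `[0, t]) truncated_drift e (U e) r.
Proof.
move=> e0 t0.
have int n : mu.-integrable `[0, t] (EFin \o truncated_drift e (picard e n)).
  apply: truncated_drift_int => //; apply: within_ray_segment => //.
  exact: picard_continuous.
have mf n : measurable_fun `[0, t] (truncated_drift e (picard e n)).
  by have /integrableP[/measurable_EFinP] := int n.
have cvf r : 0 <= r ->
    truncated_drift e (picard e n) r @[n --> \oo] --> truncated_drift e (U e) r.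
  move=> r0; apply: cvgV; first by rewrite gt_eqF// lt_max e0 orbT.
  by apply: cvg_maxr; exact: picard_cvg.
have cvf' r : `[0, t]%classic r ->
    truncated_drift e (picard e n) r @[n --> \oo] --> truncated_drift e (U e) r.
  by rewrite /= in_itv/= => /andP[r0 _]; exact: cvf.
have mU : measurable_fun `[0, t] (truncated_drift e (U e)).
  exact: measurable_fun_cvg mf cvf'.
have [| | | | |iU _ cvi] := @dominated_convergence _ _ _ mu `[0, t] (measurable_itv _)
  (fun n => EFin \o truncated_drift e (picard e n))
  (EFin \o truncated_drift e (U e)) (fun=> (e^-1)%:E).
- by move=> n; apply/measurable_EFinP; exact: mf.
- exact/measurable_EFinP.
- apply: aeW => r rt; apply: cvg_EFin; first by apply: nearW.
  exact: (cvf' r rt).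
- apply: (@segment_integrable _ (fun=> e^-1)).
  by apply: continuous_subspaceT => ?; exact: cvg_cst.
- apply: aeW => r n _; rewrite /= lee_fin.
  by case/andP: (truncated_drift_bound (picard e n) r e0) => p1 p2; rewrite ger0_norm.
split=> //.
have cvJ : \int[mu]_(r in `[0, t]) truncated_drift e (picard e n) r @[n --> \oo] -->
    \int[mu]_(r in `[0, t]) truncated_drift e (U e) r.
  apply: fine_cvg; rewrite fineK//; exact: integrable_fin_num.
have : picard e n.+1 t @[n --> \oo] -->
    x + b t - c * \int[mu]_(r in `[0, t]) truncated_drift e (U e) r.
  by apply: cvgB; [exact: cvg_cst|apply: cvgM => //; exact: cvg_cst].
move=> h1; have := picard_cvg e0 t0; rewrite -(cvg_shiftS (fun n => picard e n t)).
by move=> h2; exact: (cvg_unique _ h2 h1).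
Qed.

Lemma truncated_solution_continuous e : 0 < e ->
  {within [set t | 0 <= t], continuous (U e)}.
Proof.
move=> e0; have cI : {within [set t | 0 <= t], continuous (fun t => x + b t -
    c * \int[mu]_(r in `[0, t]) truncated_drift e (U e) r)}.
  apply: ray_shift; apply: (@primitive_continuous _ e^-1) => [t t0|r _].
    by case: (truncated_solution_eq e0 t0).
  exact: truncated_drift_bound.
apply/within_ray_eps => u u0 a a0.
have [d d0 hd] := (within_ray_eps _).1 cI u u0 a a0.
exists d => // r r0 ru; have := hd r r0 ru.
have [_ <-] := truncated_solution_eq e0 r0.
by have [_ <-] := truncated_solution_eq e0 u0.
Qed.

(** Subsolutions stay below every Picard iterate, since the drift
  [- c / max (v, e)] is nondecreasing in [v]. *)
Lemma truncated_solution_max e v t : 0 < e -> {within `[0, t], continuous v} ->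
  (forall s, 0 <= s <= t ->
     v s <= x + b s - c * \int[mu]_(r in `[0, s]) truncated_drift e v r) ->
  forall s, 0 <= s <= t -> v s <= U e s.
Proof.
move=> e0 cv vle.
have vp k s : 0 <= s <= t -> v s <= picard e k s.
  elim: k s => [|k IHk] s st; apply: le_trans (vle _ st) _.
    rewrite gerBl mulr_ge0// Rintegral_ge0// => r _.
    by case/andP: (truncated_drift_bound v r e0).
  have/andP[s0 st'] := st.
  rewrite /= lerD2l lerN2 ler_wpM2l//; apply: le_Rintegral => //.
  - apply: truncated_drift_int => //; apply: within_ray_segment => //.
    exact: picard_continuous.
  - by apply: truncated_drift_int => //; exact: within_segmentS cv.
  move=> r; rewrite /= in_itv/= => /andP[r0 rs].
  by apply: truncated_drift_le => //; apply: IHk; rewrite r0 (le_trans rs).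
move=> s st; have/andP[s0 _] := st.
apply: limr_ge; first by apply/cvg_ex; exists (U e s); exact: picard_cvg.
by apply: nearW => k; exact: vp.
Qed.

Lemma truncated_solution_mono e e' t : 0 < e' -> e' <= e -> 0 <= t ->
  U e' t <= U e t.
Proof.
move=> e'0 ee t0; have e0 := lt_le_trans e'0 ee.
have cU := truncated_solution_continuous e'0.
apply: (@truncated_solution_max _ _ t); rewrite ?t0 ?lexx//.
  exact: within_ray_segment cU.
move=> s /andP[s0 st]; have [is_ ->] := truncated_solution_eq e'0 s0.
rewrite lerD2l lerN2 ler_wpM2l//; apply: le_Rintegral => //.
  by apply: truncated_drift_int => //; exact: within_ray_segment cU.
by move=> r _; exact: truncated_drift_le.
Qed.

(** While the solution for [e] stays above [e], it also solves the equation for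
  [e'], so maximality bounds it by the solution for [e']; the other inequality
  is monotonicity in the truncation level. *)
Lemma truncated_solution_agree e e' t : 0 < e' -> e' <= e ->
  (forall s, 0 <= s <= t -> e <= U e s) ->
  forall s, 0 <= s <= t -> U e' s = U e s.
Proof.
move=> e'0 ee Ue s /andP[s0 st]; have e0 := lt_le_trans e'0 ee.
apply/eqP; rewrite eq_le truncated_solution_mono//=.
apply: (@truncated_solution_max _ _ t); rewrite ?s0//.
  by apply: within_ray_segment => //; exact: truncated_solution_continuous.
move=> u /andP[u0 ut]; have [_ ->] := truncated_solution_eq e0 u0.
rewrite lerD2l lerN2 ler_wpM2l// le_eqVlt; apply/orP; left; apply/eqP.
apply: eq_Rintegral => r; rewrite inE/= in_itv/= => /andP[r0 ru].
have Ur : e <= U e r by apply: Ue; rewrite r0 (le_trans ru).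
rewrite /truncated_drift (max_idPl Ur) (_ : Num.max _ _ = U e r)//.
by apply/max_idPl; exact: le_trans Ur.
Qed.

End Existence.

(** * Existence of the solution up to the hitting time *)

Section BesselExistence.
Variables (R : realType) (b : R -> R) (delta x : R).
Hypotheses (cb : {within [set t | 0 <= t], continuous b}) (b0 : b 0 = 0).
Hypotheses (d0 : delta <= 0) (x0 : 0 < x).
Notation mu := (@lebesgue_measure R).

Let c := (1 - delta) / 2.
Let c0 : 0 <= c.
Proof. move: d0; rewrite /c => ?; lra. Qed.
Let eps (n : nat) : R := n.+1%:R^-1.
Let eps_gt0 n : 0 < eps n. Proof. by rewrite invr_gt0. Qed.
Let epsS n m : (n <= m)%N -> eps m <= eps n.
Proof. by move=> nm; rewrite lef_pV2 ?posrE// ler_nat ltnS. Qed.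
Let U n := truncated_solution b c x (eps n).
Let alive t n := forall s, 0 <= s <= t -> eps n <= U n s.
Let sol t := let n := xget 0%N (alive t) in if `[< alive t n >] then U n t else 0.

Let aliveS t t' n : t' <= t -> alive t n -> alive t' n.
Proof. by move=> tt an s /andP[s0 st]; apply: an; rewrite s0 (le_trans st). Qed.

Let alive_agree t n m : (n <= m)%N -> alive t n ->
  forall s, 0 <= s <= t -> U m s = U n s.
Proof. by move=> nm an; apply: (truncated_solution_agree cb c0) => //; exact: epsS. Qed.

Let aliveW t n m : (n <= m)%N -> alive t n -> alive t m.
Proof.
move=> nm an s st; rewrite (alive_agree nm an st).
exact: le_trans (epsS nm) (an _ st).
Qed.

Let sol_alive t n s : alive t n -> 0 <= s <= t -> sol s = U n s.
Proof.
move=> an /andP[s0 st]; rewrite /sol; case: xgetP => [k _ ak|/(_ n)]; last first.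
  by move=> /(_ (aliveS st an)).
have ans := aliveS st an.
rewrite asboolT//; have [kn|/ltnW nk] := leqP k n.
  by rewrite -(alive_agree kn ak)// s0 lexx.
by rewrite (alive_agree nk ans)// s0 lexx.
Qed.

Let sol_dead t : (forall n, ~ alive t n) -> sol t = 0.
Proof. by move=> nt; rewrite /sol; case: asboolP => // /nt. Qed.

Let cU n : {within [set t | 0 <= t], continuous (U n)}.
Proof. exact: truncated_solution_continuous. Qed.

Let alive_open t n : 0 <= t -> alive t n -> exists2 e, 0 < e & exists m, alive (t + e) m.
Proof.
move=> t0 an; have aS := aliveW (leqnSn n) an.
have ee : eps n.+1 < eps n by rewrite ltf_pV2 ?posrE// ltr_nat.
have Ut s : 0 <= s <= t -> eps n <= U n.+1 s.
  by move=> st; rewrite (alive_agree (leqnSn n) an)// an.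
have e0 : 0 < eps n - eps n.+1 by rewrite subr_gt0.
have [d d_gt0 hd] := (within_ray_eps _).1 (@cU n.+1) t t0 _ e0.
exists (d / 2); first by rewrite divr_gt0.
exists n.+1 => s /andP[s0 st]; have [st'|ts] := leP s t.
  by apply: aS; rewrite s0.
have : `|U n.+1 s - U n.+1 t| < eps n - eps n.+1.
  by apply: hd => //; rewrite gtr0_norm ?subr_gt0//; lra.
have := Ut t; rewrite t0 lexx => /(_ isT).
by rewrite ltr_norml => ? /andP[]; lra.
Qed.

Let alive0 : exists n, alive 0 n.
Proof.
have [n _ nx] : exists2 n, True & eps n <= x.
  exists (Num.truncn x^-1) => //; rewrite invf_ple ?posrE// ltW// .
  by have := truncnS_gt x^-1.
exists n => s; rewrite -eq_le => /eqP <-.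
rewrite /U; have [_ ->] := truncated_solution_eq x cb c0 (eps_gt0 n) (lexx 0).
by rewrite set_itv1 Rintegral_set1 mulr0 subr0 b0 addr0.
Qed.

Let alive_hit t n : 0 <= t -> alive t n -> (t%:E < hitting_time0 sol)%E.
Proof.
move=> t0 an; have [e e0 [m am]] := alive_open t0 an.
apply: (@lt_le_trans _ _ (t + e)%:E); first by rewrite lte_fin ltrDl.
apply: le_ereal_inf_tmp => _ [u [u0 zu] <-]; rewrite lee_fin leNgt.
apply/negP => ut; have us : 0 <= u <= t + e by rewrite !ltW.
have := am _ us; rewrite -(sol_alive am us) zu.
by have := eps_gt0 m; lra.
Qed.

Let hit_alive t : 0 <= t -> (t%:E < hitting_time0 sol)%E -> exists n, alive t n.
Proof.
move=> t0 th; apply: contrapT => /forallNP nt.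
have z0 := sol_dead nt; move: th; rewrite ltNge => /negP; apply.
apply: hitting_time0_le => //; rewrite lt_neqAle t0 andbT.
by apply/negP => /eqP tE; have [n] := alive0; rewrite tE; exact: nt.
Qed.

Let sol_eq t n : 0 <= t -> alive t n ->
  sol t = x + b t - c * \int[mu]_(r in `[0, t]) (sol r)^-1.
Proof.
move=> t0 an; rewrite (sol_alive an) ?t0 ?lexx//.
rewrite /U; have [_ ->] := truncated_solution_eq x cb c0 (eps_gt0 n) t0.
congr (_ - c * _); apply: eq_Rintegral => r; rewrite inE/= in_itv/= => rt.
rewrite (sol_alive an rt) /truncated_drift; congr (_^-1).
by apply/max_idPl; exact: an.
Qed.

Let sol_decrease s t n : 0 <= s -> s <= t -> alive t n ->
  sol t - sol s <= b t - b s.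
Proof.
move=> s0 st an; have t0 := le_trans s0 st.
have ps : positive_solution b c x sol t.
  split.
  - have := @within_ray_segment _ _ 0 t (lexx _) (@cU n).
    move=> /within_segment_eps cUt; apply/within_segment_eps => u ut e e0.
    have [d d_gt0 hd] := cUt u ut e e0; exists d => // r rt ru.
    by rewrite (sol_alive an rt) (sol_alive an ut); exact: hd.
  - move=> r rt; rewrite (sol_alive an rt).
    exact: lt_le_trans (eps_gt0 n) (an _ rt).
  - by move=> r /andP[r0 rt]; apply: (@sol_eq _ n) => //; exact: aliveS an.
rewrite (positive_solution_incr ps s0 st (lexx _)) gerBl mulr_ge0//.
apply: Rintegral_ge0 => r; rewrite /= in_itv/= => /andP[sr rt].
by have [_ + _] := ps => /(_ r); rewrite (le_trans s0 sr) rt => /(_ isT) /ltW; rewrite invr_ge0.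
Qed.

(** Approaching a dead time, the path comes within [eps n] of zero for every
  [n], and from there it can only rise as much as [b] does. *)
Let sol_continuous : {within [set t | 0 <= t], continuous sol}.
Proof.
apply/within_ray_eps => t t0 e e0.
have [[n an]|/forallNP nt] := pselect (exists n, alive t n).
  have [h h0 [m am]] := alive_open t0 an.
  have [d d_gt0 hd] := (within_ray_eps _).1 (@cU m) t t0 _ e0.
  exists (Num.min d h); first by rewrite lt_min d_gt0.
  move=> r r0; rewrite lt_min => /andP[rd].
  rewrite ltr_norml => /andP[_ rh].
  by rewrite !(sol_alive am) ?r0 ?t0 ?hd//=; lra.
have tp : 0 < t.
  rewrite lt_neqAle t0 andbT; apply/negP => /eqP tE.
  by have [n] := alive0; rewrite tE; exact: nt.
have e4 : 0 < e / 4 by lra.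
have [d d_gt0 hd] := (within_ray_eps _).1 cb t t0 _ e4.
rewrite (sol_dead nt).
suff [d' d'0 hd'] : exists2 d', 0 < d' &
    forall r k, t - d' < r -> 0 <= r -> r < t -> alive r k -> `|sol r| < e.
  exists d' => // r r0; rewrite ltr_norml subr0 => /andP[rt _].
  have [[k ak]|/forallNP nr] := pselect (exists n, alive r n); last first.
    by rewrite (sol_dead nr) normr0.
  apply: (hd' _ k) => //; first by lra.
  rewrite ltNge; apply/negP => tr; exact: (nt k (aliveS tr ak)).
pose u := Num.max 0 (t - d / 2).
have u0 : 0 <= u by rewrite le_max lexx.
have ut : u < t by rewrite gt_max tp/=; lra.
have ud : t - d / 2 <= u by rewrite le_max lexx orbT.
have [[k ak]|/forallNP nu] := pselect (exists n, alive u n); last first.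
  exists (t - u); first by rewrite subr_gt0.
  move=> r m ru r0 rt /aliveS am; exfalso; apply: (nu m); apply: am; lra.
have [n0 _ n0e] : exists2 n, True & eps n < e / 2.
  exists (Num.truncn (e / 2)^-1) => //; rewrite invf_plt ?posrE ?divr_gt0//.
  exact: truncnS_gt.
pose n := maxn n0 k.
have ne : eps n < e / 2 by apply: le_lt_trans n0e; apply: epsS; rewrite leq_maxl.
have an : alive u n by apply: aliveW ak; rewrite leq_maxr.
have [s [s0 st sn]] : exists s, [/\ 0 <= s, s < t & U n s < eps n].
  have [s [/andP[s0 st] sn]] : exists s, 0 <= s <= t /\ U n s < eps n.
    apply: contrapT => /forallNP h; apply: (nt n) => s st.
    by rewrite leNgt; apply/negP => ?; apply: (h s).
  have [st'|ts] := ltP s t; first by exists s.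
  have sE : s = t by apply/eqP; rewrite eq_le st.
  have a0 : 0 < eps n - U n t by rewrite -sE subr_gt0.
  have [a a_gt0 ha] := (within_ray_eps _).1 (@cU n) t t0 _ a0.
  exists (Num.max 0 (t - a / 2)); split.
  - by rewrite le_max lexx.
  - by rewrite gt_max tp/=; lra.
  have := ha (Num.max 0 (t - a / 2)); rewrite le_max lexx => /(_ isT).
  have q1 : Num.max 0 (t - a / 2) < t by rewrite gt_max tp/=; lra.
  have q2 : t - a / 2 <= Num.max 0 (t - a / 2) by rewrite le_max lexx orbT.
  rewrite [X in X < a]ltr0_norm ?subr_lt0// ltr_norml.
  by move=> h; have /h/andP[] : - (Num.max 0 (t - a / 2) - t) < a; lra.
have us : u < s.
  by rewrite ltNge; apply/negP => su; have := an s; rewrite s0 su => /(_ isT); lra.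
have [[m am]|/forallNP ns] := pselect (exists n, alive s n); last first.
  exists (t - s); first by rewrite subr_gt0.
  move=> r m rs r0 rt /aliveS am; exfalso; apply: (ns m); apply: am; lra.
exists (t - s); first by rewrite subr_gt0.
move=> r l rs r0 rt al.
have sr : s <= r by lra.
have Us : sol s < e / 2.
  have := aliveW (leq_maxr n m) am => amx.
  rewrite (sol_alive amx) ?s0 ?lexx//.
  apply: le_lt_trans (lt_trans sn ne).
  by apply: truncated_solution_mono => //; apply: epsS; rewrite leq_maxl.
have := sol_decrease s0 sr al.
have : `|b r - b t| < e / 4 by apply: hd => //; rewrite ltr_norml; apply/andP; split; lra.
have : `|b s - b t| < e / 4 by apply: hd => //; rewrite ltr_norml; apply/andP; split; lra.
rewrite !ltr_norml => /andP[? ?] /andP[? ?] ?.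
have : 0 < sol r.
  rewrite (sol_alive al) ?r0 ?lexx//.
  by apply: lt_le_trans (eps_gt0 l) (al _ _); rewrite r0 lexx.
by move=> ?; apply/andP; split; lra.
Qed.

(** The solution follows the truncated solutions as long as one of them is still
  above its truncation level, and is zero afterwards. *)
Lemma bessel_exists : exists z, is_bessel b delta x z.
Proof.
exists sol; split.
- exact: sol_continuous.
- have [n an] := alive0.
  by rewrite (sol_eq (lexx 0) an) set_itv1 Rintegral_set1 mulr0 subr0 b0 addr0.
- move=> t t0 th; have [n an] := hit_alive t0 th.
  by rewrite (sol_eq t0 an) /c; field.
move=> t th; have t0 : 0 <= t by rewrite -lee_fin (le_trans _ th)// hitting_time0_ge0.
by apply: sol_dead => n an; have := alive_hit t0 an; rewrite ltNge th.
Qed.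

End BesselExistence.

(** * Survivors stay away from zero *)

Section DeterministicContinuity.
Variable R : realType.
Notation mu := (@lebesgue_measure R).
Implicit Types (b z : R -> R).

Lemma segment_unif_continuous b (s t : R) : {within `[s, t], continuous b} ->
  forall e, 0 < e -> exists2 d, 0 < d & forall u v, s <= u <= t -> s <= v <= t ->
    `|u - v| < d -> `|b u - b v| < e.
Proof.
move=> /within_segment_eps cb e e0.
have /compact_near_coveringP ncov := @segment_compact _ s t.
have [|d /= d0 hd] := ncov R 0^'+ (fun d v => s <= v <= t -> forall u, s <= u <= t ->
  `|u - v| < d -> `|b u - b v| < e) _.
  move=> u; rewrite /= in_itv/= => ut.
  have e2 : 0 < e / 2 by rewrite divr_gt0.
  have [d d0 hd] := cb u ut _ e2.
  have d2 : 0 < d / 2 by rewrite divr_gt0.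
  exists ([set v | `|u - v| < d / 2], [set a | a < d / 2]).
    split; first by exists (d / 2).
    exact: nbhs_right_lt.
  move=> [v a]/= [uv ad] vt w wt wv.
  have h1 : `|b v - b u| < e / 2.
    by apply: hd => //; rewrite distrC (lt_le_trans uv)// ler_pdivrMr// ler_pMr; lra.
  have h2 : `|b w - b u| < e / 2.
    apply: hd => //; rewrite -(subrKA v); apply: le_lt_trans (ler_normD _ _) _.
    by rewrite distrC in uv; lra.
  rewrite -(subrKA (b u)); apply: le_lt_trans (ler_normD _ _) _.
  by rewrite (distrC (b u)); lra.
exists (d / 2) => //; first by rewrite divr_gt0.
move=> u v us vs uv; apply: (hd (d / 2)) => //=.
- by rewrite sub0r normrN gtr0_norm ?divr_gt0//; lra.
- by rewrite divr_gt0.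
Qed.

(** A solution alive at time [T] at a height at least [y] was never close to
  zero before; reading time backwards from [T], this says that the Bessel
  process of dimension [2 - delta >= 2] does not hit zero. *)
Definition stays_away b (T y C : R) := exists2 rho, 0 < rho &
  forall c x z, 1 / 2 <= c <= C -> positive_solution b c x z T -> y <= z T ->
    forall s, 0 <= s <= T -> rho <= z s.

(** Only countably many triples [(T, y, C)] are used, so that almost sure
  statements can be combined; the times form a dense set. *)
Definition repelling b := forall i j k l : nat,
  stays_away b (i.+1%:R / j.+1%:R) k.+1%:R^-1 l%:R.

Variable b : R -> R.
Hypothesis cb : {within [set t | 0 <= t], continuous b}.
Hypothesis rb : repelling b.

Lemma finite_stays_away (N k l n : nat) : exists2 rho, 0 < rho &
  forall i, (i < n)%N -> forall c x z, 1 / 2 <= c <= l%:R ->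
    positive_solution b c x z (i.+1%:R / N.+1%:R) ->
    k.+1%:R^-1 <= z (i.+1%:R / N.+1%:R) ->
    forall s, 0 <= s <= i.+1%:R / N.+1%:R -> rho <= z s.
Proof.
elim: n => [|n [rho rho0 IHn]]; first by exists 1.
have [rho' rho'0 hn] := rb n N k l.
exists (Num.min rho rho'); first by rewrite lt_min rho0.
move=> i; rewrite ltnS leq_eqVlt => /predU1P[->|/IHn h] c x z cl pz zk s st.
  by rewrite ge_min (hn _ _ _ cl pz)// orbT.
by rewrite ge_min (h _ _ _ cl pz).
Qed.

(** A solution alive on [0, T1] has [c] times the integral of its inverse
  bounded by [X + b T1], hence is high at some time between [T0] and [T1], and
  nearly as high at the grid point preceding that time. *)
Lemma survivors_stay_away (T0 T1 X C : R) : 0 <= T0 -> T0 < T1 -> 0 < X ->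
  exists2 rho, 0 < rho & forall c x z, 1 / 2 <= c <= C -> 0 < x <= X ->
    positive_solution b c x z T1 -> forall s, 0 <= s <= T0 -> rho <= z s.
Proof.
move=> T00 T01 X0; pose Th := (T0 + T1) / 2.
pose M := X + `|b T1|; have M0 : 0 < M by rewrite ltr_pwDl.
pose m := (T1 - Th) / (4 * M).
have Th1 : 0 < T1 - Th by rewrite /Th; lra.
have m0 : 0 < m by rewrite divr_gt0// mulr_gt0.
have m2 : 0 < m / 2 by rewrite divr_gt0.
have [d d0 hd] := segment_unif_continuous (@within_ray_segment _ _ 0 T1 (lexx 0) cb) m2.
have dT : 0 < Num.min d (Th - T0) by rewrite lt_min d0 /Th/=; lra.
have [N _ Nd] : exists2 N, True & N.+1%:R^-1 < Num.min d (Th - T0).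
  exists (Num.truncn (Num.min d (Th - T0))^-1) => //.
  by rewrite invf_plt ?posrE//; exact: truncnS_gt.
have [k _ km] : exists2 k, True & k.+1%:R^-1 < m / 2.
  exists (Num.truncn (m / 2)^-1) => //.
  by rewrite invf_plt ?posrE//; exact: truncnS_gt.
pose l := (Num.truncn C).+1.
have Cl : C < l%:R by exact: truncnS_gt.
have Np : 0 < N.+1%:R :> R by [].
have [rho rho0 hrho] := finite_stays_away N k l (Num.truncn (T1 * N.+1%:R)).+1.
exists rho => // c x z /andP[c2 cC] /andP[x0 xX] pz s /andP[s0 sT0].
have [t tT zt] : exists2 t, Th <= t <= T1 & m <= z t.
  apply: contrapT => /forall2NP h.
  have zm t : Th <= t <= T1 -> z t < m.
    by move=> tT; rewrite ltNge; apply/negP => mt; case: (h t).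
  have Th0 : 0 <= Th by rewrite /Th; lra.
  have ThT1 : Th <= T1 by lra.
  have T10 : 0 <= T1 by lra.
  have [_ zp ze] := pz.
  have ip := positive_solution_int pz.
  have z1 := ze T1; rewrite T10 lexx in z1; have {}z1 := z1 isT.
  have z1p := zp T1; rewrite T10 lexx in z1p; have {}z1p := z1p isT.
  rewrite (Rintegral_segment_split Th0 ThT1 ip) in z1.
  have I1 : 0 <= \int[mu]_(r in `[0, Th]) (z r)^-1.
    apply: Rintegral_ge0 => r; rewrite /= in_itv/= => /andP[r0 rT].
    by rewrite invr_ge0 ltW// zp// r0 (le_trans rT).
  have I2 : m^-1 * (T1 - Th) <= \int[mu]_(r in `[Th, T1]) (z r)^-1.
    apply: Rintegral_segment_ge => //; first exact: (positive_solution_intS pz).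
    move=> r rT; have /andP[r1 r2] := rT.
    have zr : 0 < z r by apply: zp; rewrite (le_trans Th0).
    by rewrite lef_pV2 ?posrE// ltW// zm.
  have mE : m^-1 * (T1 - Th) = 4 * M by rewrite /m; field; rewrite !gt_eqF.
  rewrite mE in I2; have bT := ler_norm (b T1).
  have cI : 1 / 2 * (4 * M) <= c * (\int[mu]_(r in `[0, Th]) (z r)^-1 +
      \int[mu]_(r in `[Th, T1]) (z r)^-1).
    apply: ler_pM => //; first by rewrite mulr_ge0// ltW.
    by apply: le_trans I2 _; rewrite lerDr.
  move: z1 cI; set S := c * _ => z1 cI.
  have ME : M = X + `|b T1| by [].
  by clear -z1 cI ME z1p bT xX M0; lra.
have /andP[Tt tT1] := tT; have t0 : 0 <= t by rewrite /Th in Tt; lra.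
have tN0 : 0 <= t * N.+1%:R by rewrite mulr_ge0.
have /andP[it ti] := truncn_itv tN0; set i := Num.truncn _ in it ti.
have it' : i%:R / N.+1%:R <= t by rewrite ler_pdivrMr.
have ti' : t - N.+1%:R^-1 < i%:R / N.+1%:R.
  rewrite ltrBlDr -[X in _ + X]mul1r -mulrDl ltr_pdivlMr//.
  by rewrite natr1.
move: Nd; rewrite lt_min => /andP[Nd NT].
have gT0 : T0 < i%:R / N.+1%:R.
  by apply: lt_trans ti'; rewrite ltrBrDr (lt_le_trans _ Tt)// -ltrBrDl.
have i0 : (0 < i)%N.
  rewrite lt0n; apply/eqP => iE; move: gT0; rewrite iE mul0r; lra.
have [g gE] : exists g : R, g = i%:R / N.+1%:R by exists (i%:R / N.+1%:R).
rewrite -gE in it' ti' gT0.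
have pzi : positive_solution b c x z g.
  by apply: positive_solutionS pz; lra.
have zi : m / 2 <= z g.
  have g0 : 0 <= g by lra.
  have I0 : 0 <= c * \int[mu]_(r in `[g, t]) (z r)^-1.
    apply: mulr_ge0; first by lra.
    apply: Rintegral_ge0 => r; rewrite /= in_itv/= => /andP[r0 rT].
    have [_ zp _] := pz.
    by rewrite invr_ge0 ltW// zp// (le_trans g0 r0) (le_trans rT).
  have hb : `|b t - b g| < m / 2.
    apply: hd; first by rewrite t0.
    - by rewrite g0; lra.
    - by rewrite ger0_norm ?subr_ge0// (lt_trans _ Nd)// ltrBlDr -ltrBlDl.
  have {}hb : b t - b g < m / 2 by move: hb; rewrite ltr_norml => /andP[].
  move: I0 (positive_solution_incr pz g0 it' tT1); set S := c * _ => I0 hinc.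
  by clear -I0 hinc hb zt; lra.
rewrite {}gE -(prednK i0) in pzi zi gT0.
apply: (hrho _ _ c x z _ pzi) => //.
- by rewrite prednK// leqW// le_truncn// ler_pM2r.
- by rewrite c2 (le_trans cC)// ltW.
- exact: le_trans (ltW km) zi.
- by rewrite s0 (le_trans sT0)// ltW.
Qed.

End DeterministicContinuity.

(** * Continuity of the hitting time for a repelling path *)

Section ZetaContinuity.
Variable R : realType.
Implicit Types (b z : R -> R).

Lemma hitting_time0_opp z : hitting_time0 (fun r => - z r) = hitting_time0 z.
Proof.
rewrite /hitting_time0; congr (ereal_inf (_ @` _)).
by apply/seteqP; split => t [t0 /eqP];
  rewrite ?oppr_eq0 => /eqP zt; split=> //; rewrite zt oppr0.
Qed.

(** No integrability is assumed: when the integral is undefined or infinite,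
  both sides are 0 because [fine] maps infinities to 0. *)
Lemma Rintegral_opp (D : set R) (f : R -> R) :
  \int[lebesgue_measure]_(r in D) (- f r) =
  - \int[lebesgue_measure]_(r in D) f r.
Proof.
pose g r := (f r)%:E; pose h r := (- f r)%:E.
rewrite /Rintegral -[X in fine X]/(\int[lebesgue_measure]_(r in D) h r)%E.
rewrite -[X in - fine X]/(\int[lebesgue_measure]_(r in D) g r)%E.
rewrite integralE [in RHS]integralE.
have -> : h^\+%E = g^\-%E by apply/funext => r; rewrite funeposE funenegE /h /g EFinN.
have -> : h^\-%E = g^\+%E.
  by apply/funext => r; rewrite funeposE funenegE /h /g EFinN oppeK.
by case: (integral _ _ _) => [u| |]; case: (integral _ _ _) => [v| |] //=;
  rewrite ?oppr0// opprB.
Qed.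

Lemma is_bessel_opp b delta x z : is_bessel b delta x z ->
  is_bessel (fun t => - b t) delta (- x) (fun t => - z t).
Proof.
move=> [cz z0 ze zz]; rewrite /is_bessel hitting_time0_opp; split.
- exact: within_opp.
- by rewrite z0.
- move=> t t0 th; rewrite ze//.
  under [in RHS]eq_Rintegral do rewrite invrN.
  by rewrite Rintegral_opp; ring.
- by move=> t th; rewrite zz// oppr0.
Qed.

Section PositiveStart.
Variable b : R -> R.
Hypothesis cb : {within [set t | 0 <= t], continuous b}.
Hypothesis rb : repelling b.

Lemma hitting_time0_lower x0 delta0 z0 a : 0 < x0 -> delta0 <= 0 ->
  is_bessel b delta0 x0 z0 -> (a%:E < hitting_time0 z0)%E ->
  exists2 th, 0 < th & forall delta x z, `|delta - delta0| < th ->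
    `|x - x0| < th -> 0 < x -> is_bessel b delta x z ->
    (a%:E < hitting_time0 z)%E.
Proof.
move=> x00 d0 bz0 az0; have [a0|a0] := ltP a 0.
  exists 1 => // delta x z _ _ _ _.
  by rewrite (lt_le_trans _ (hitting_time0_ge0 z))// lte_fin.
have pz0 := bessel_positive_solution x00 bz0 a0 az0.
have [th th0 h] := solution_stability a0 d0 pz0 ltr01.
by exists th => // delta x z dd xx xp bz; case: (h _ _ _ dd xx xp bz).
Qed.

(** A solution with nearby parameters which is still alive after [T1] stays above
  some fixed [rho] on [0, T0]; but just before the hitting time [tau < T0] it is
  close to [z0], which is already below [rho / 2]. *)
Lemma hitting_time0_upper x0 delta0 z0 a : 0 < x0 -> delta0 <= 0 ->
  is_bessel b delta0 x0 z0 -> (hitting_time0 z0 < a%:E)%E ->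
  exists2 th, 0 < th & forall delta x z, delta <= 0 -> `|delta - delta0| < th ->
    `|x - x0| < th -> 0 < x -> is_bessel b delta x z ->
    (hitting_time0 z < a%:E)%E.
Proof.
move=> x00 d0 bz0; have := hitting_time0_ge0 z0.
case hz : (hitting_time0 z0) => [tau| |]//; rewrite lee_fin lte_fin => tau0 taua.
have [cz z00 ze zz] := bz0.
have ztau : z0 tau = 0 by apply: zz; rewrite hz.
have taup : 0 < tau.
  rewrite lt_neqAle tau0 andbT; apply/eqP => tE.
  by move: ztau; rewrite -tE z00 => xE; move: x00; rewrite xE ltxx.
pose T0 := (2 * tau + a) / 3; pose T1 := (tau + 2 * a) / 3.
have T00 : 0 <= T0 by rewrite /T0; lra.
have T01 : T0 < T1 by rewrite /T0 /T1; lra.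
have tT0 : tau < T0 by rewrite /T0; lra.
have T1a : T1 < a by rewrite /T1; lra.
have X0 : 0 < x0 + 1 by rewrite addr_gt0.
have [rho rho0 hrho] := survivors_stay_away cb rb ((1 - delta0) / 2 + 1) T00 T01 X0.
have [s [s0 st zs]] : exists s, [/\ 0 <= s, s < tau & z0 s < rho / 2].
  have r2 : 0 < rho / 2 by rewrite divr_gt0.
  have [d d_gt0 hd] := (within_ray_eps _).1 cz _ tau0 _ r2.
  have q1 : 0 <= Num.max 0 (tau - d / 2) by rewrite le_max lexx.
  have q2 : Num.max 0 (tau - d / 2) < tau by rewrite gt_max taup/=; lra.
  have q3 : tau - d / 2 <= Num.max 0 (tau - d / 2) by rewrite le_max lexx orbT.
  exists (Num.max 0 (tau - d / 2)); split=> //.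
  have : `|z0 (Num.max 0 (tau - d / 2)) - z0 tau| < rho / 2.
    by apply: hd => //; rewrite ltr0_norm ?subr_lt0//; lra.
  by rewrite ztau subr0 => /(le_lt_trans (ler_norm _)).
have sh : (s%:E < hitting_time0 z0)%E by rewrite hz lte_fin.
have pz0 := bessel_positive_solution x00 bz0 s0 sh.
have r2 : 0 < rho / 2 by rewrite divr_gt0.
have [th th0 h] := solution_stability s0 d0 pz0 r2.
exists (Num.min th 1); first by rewrite lt_min th0/=.
move=> delta x z d0'; rewrite !lt_min => /andP[dd dd1] /andP[xx xx1] x_gt0 bz.
have [_ zs'] := h _ _ _ dd xx x_gt0 bz.
apply: (@le_lt_trans _ _ T1%:E); last by rewrite lte_fin.
rewrite leNgt; apply/negP => Tz.
have pz := bessel_positive_solution x_gt0 bz (le_trans T00 (ltW T01)) Tz.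
have := hrho _ x z _ _ pz s _.
move: dd1 xx1 zs'; rewrite !ltr_norml => /andP[? ?] /andP[? ?] /andP[? ?].
have c1 : 1 / 2 <= (1 - delta) / 2 <= (1 - delta0) / 2 + 1 by apply/andP; split; lra.
have c2 : 0 < x <= x0 + 1 by apply/andP; split; lra.
have c3 : 0 <= s <= T0 by apply/andP; split; lra.
by move=> /(_ c1 c2 c3); lra.
Qed.

(** A solution alive after [a / 2] starts above some fixed [rho]. *)
Lemma hitting_time0_start0 delta0 a : 0 < a -> delta0 <= 0 ->
  exists2 th, 0 < th & forall delta x z, delta <= 0 -> `|delta - delta0| < th ->
    0 < x -> x < th -> is_bessel b delta x z -> (hitting_time0 z < a%:E)%E.
Proof.
move=> a0 d0; have T00 : 0 <= a / 3 by lra.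
have T01 : a / 3 < a / 2 by lra.
have [rho rho0 hrho] := survivors_stay_away cb rb ((1 - delta0) / 2 + 1) T00 T01 ltr01.
exists (Num.min rho 1); first by rewrite lt_min rho0/=.
move=> delta x z d0'; rewrite !lt_min => /andP[dd dd1] x0 /andP[xr x1] bz.
apply: (@le_lt_trans _ _ (a / 2)%:E); last by rewrite lte_fin; lra.
rewrite leNgt; apply/negP => Tz.
have pz := bessel_positive_solution x0 bz (le_trans T00 (ltW T01)) Tz.
have := hrho _ x z _ _ pz 0 _.
move: dd1; rewrite !ltr_norml => /andP[? ?].
have c1 : 1 / 2 <= (1 - delta) / 2 <= (1 - delta0) / 2 + 1 by apply/andP; split; lra.
have c2 : 0 < x <= 1 by apply/andP; split; lra.
have c3 : 0 <= (0 : R) <= a / 3 by apply/andP; split; lra.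
move=> /(_ c1 c2 c3); have [_ -> _ _] := bz.
by rewrite leNgt xr.
Qed.

End PositiveStart.

Lemma zeta_solution b delta x :
  {within [set t | 0 <= t], continuous b} -> b 0 = 0 -> delta <= 0 -> x != 0 ->
  exists z, zeta b delta x = hitting_time0 z /\
    is_bessel (if 0 < x then b else fun t => - b t) delta `|x| z.
Proof.
move=> cb b0 d0 xn0; rewrite /zeta (negbTE xn0).
have bz : exists z, is_bessel b delta x z.
  have [x0|] := ltP 0 x; first exact: bessel_exists.
  rewrite le_eqVlt (negbTE xn0)/= => x0.
  have [||||z bz] := @bessel_exists R (fun t => - b t) delta (- x).
  - exact: within_opp.
  - by rewrite b0 oppr0.
  - by [].
  - by rewrite oppr_gt0.
  exists (fun t => - z t); have := is_bessel_opp bz.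
  by rewrite opprK (_ : (fun t => - - b t) = b)//; apply/funext => t; rewrite opprK.
have bb : is_bessel b delta x (bessel b delta x).
  exact: (xgetPex (cst 0) bz).
case: ltP => x0; first by exists (bessel b delta x); rewrite gtr0_norm.
exists (fun t => - bessel b delta x t); rewrite hitting_time0_opp; split=> //.
by rewrite ler0_norm//; exact: is_bessel_opp.
Qed.

Lemma cvg_ereal_order (T : Type) (F : set_system T) (f : T -> \bar R) (l : \bar R) :
  Filter F -> (0 <= l)%E ->
  (forall a, (a%:E < l)%E -> \forall p \near F, (a%:E < f p)%E) ->
  (forall a, (l < a%:E)%E -> \forall p \near F, (f p < a%:E)%E) ->
  f @ F --> l.
Proof.
move=> FF; case: l => [l| |]// _ lo up; last first.
  by apply/cvgeyPgt => a; apply: lo; rewrite ltry.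
move=> A; rewrite /= /nbhs/= => -[e/= e0 he].
have h1 : ((l - e)%:E < l%:E)%E by rewrite lte_fin; lra.
have h2 : (l%:E < (l + e)%:E)%E by rewrite lte_fin; lra.
rewrite /nbhs/=; near=> p.
have p1 : ((l - e)%:E < f p)%E by near: p; exact: lo.
have p2 : (f p < (l + e)%:E)%E by near: p; exact: up.
move: p1 p2; rewrite /preimage/=; case: (f p) => [r| |]//; rewrite !lte_fin => p1 p2.
by apply: he => /=; rewrite ltr_norml; apply/andP; split; lra.
Unshelve. all: by end_near.
Qed.

Theorem zeta_continuous b :
  {within [set t | 0 <= t], continuous b} -> b 0 = 0 ->
  repelling b -> repelling (fun t => - b t) ->
  {within [set p : R * R | p.2 <= 0],
    continuous (fun p : R * R => zeta b p.2 p.1)}.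
Proof.
move=> cb b0 rb rNb; apply/subspace_continuousP => -[x0 delta0]/= d0; rewrite /from_subspace/=.
have cNb := within_opp cb.
have near_p th : 0 < th -> \forall p \near within [set p : R * R | p.2 <= 0]
    (nbhs (x0, delta0)), p.2 <= 0 /\ `|p.2 - delta0| < th /\ `|p.1 - x0| < th.
  move=> th0; rewrite near_withinE.
  exists ([set x | `|x0 - x| < th], [set x | `|delta0 - x| < th]) => /=.
    by split; exists th.
  by move=> [x delta]/= [xx dd] dl; rewrite distrC [`|x - _|]distrC.
have [x00|x0n0] := eqVneq x0 0.
  have z00 : zeta b delta0 x0 = 0%E by rewrite /zeta x00 eqxx.
  apply: cvg_ereal_order => /=; rewrite ?z00//.
  - move=> a; rewrite lte_fin => a0; near=> p.
    rewrite /zeta; case: eqP => _; rewrite ?lte_fin//.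
    by rewrite (lt_le_trans _ (hitting_time0_ge0 _))// lte_fin.
  move=> a; rewrite lte_fin => a0.
  have [t1 t10 h1] := hitting_time0_start0 cb rb a0 d0.
  have [t2 t20 h2] := hitting_time0_start0 cNb rNb a0 d0.
  have t0 : 0 < Num.min t1 t2 by rewrite lt_min t10.
  apply: filterS (near_p _ t0) => -[x delta]/= [dl].
  rewrite !lt_min x00 subr0 => -[/andP[dd1 dd2] /andP[xx1 xx2]].
  have [->|xn0] := eqVneq x 0; first by rewrite /zeta eqxx lte_fin.
  have [z [-> bz]] := zeta_solution cb b0 dl xn0.
  have xp : 0 < `|x| by rewrite normr_gt0.
  case: ltP bz => _ bz; first exact: h1 bz.
  exact: h2 bz.
have [z0 [hz0 bz0]] := zeta_solution cb b0 d0 x0n0.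
have xp0 : 0 < `|x0| by rewrite normr_gt0.
have sg x : `|x - x0| < `|x0| -> (0 < x) = (0 < x0) /\ x != 0.
  move=> xx; have xn0 : x != 0.
    by apply/eqP => xE; move: xx; rewrite xE sub0r normrN ltxx.
  split=> //; case: (ltrP 0 x0) xx => x0s; rewrite ?(gtr0_norm x0s) ?(ler0_norm x0s) ltr_norml => /andP[u v].
    by lra.
  by apply/negbTE; rewrite -leNgt; lra.
have loc (Q : \bar R -> Prop) : (exists2 th, 0 < th & forall delta x z,
     delta <= 0 -> `|delta - delta0| < th ->
     `|x - `|x0| | < th -> 0 < x ->
     is_bessel (if 0 < x0 then b else (fun t => - b t)) delta x z ->
     Q (hitting_time0 z)) ->
   \forall p \near within [set p : R * R | p.2 <= 0] (nbhs (x0, delta0)),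
     Q (zeta b p.2 p.1).
  move=> [th th0 h]; have t0 : 0 < Num.min th `|x0| by rewrite lt_min th0.
  apply: filterS (near_p _ t0) => -[x delta]/= [dl].
  rewrite !lt_min => -[/andP[dd _] /andP[xx xx0]].
  have [sx xn0] := sg _ xx0.
  have [z [-> bz]] := zeta_solution cb b0 dl xn0.
  rewrite sx in bz; apply: h bz => //; last by rewrite normr_gt0.
  exact: le_lt_trans (ler_dist_dist _ _) xx.
apply: cvg_ereal_order => /=.
- by rewrite hz0; exact: hitting_time0_ge0.
- move=> a; rewrite hz0 => az; apply: (loc (fun y => is_true (a%:E < y)%E)).
  have [th th0 h] : exists2 th, 0 < th & forall delta x z, `|delta - delta0| < th ->
    `|x - `|x0| | < th -> 0 < x ->
    is_bessel (if 0 < x0 then b else (fun t => - b t)) delta x z ->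
    (a%:E < hitting_time0 z)%E.
    by case: ltP bz0 => _ bz0; exact: (hitting_time0_lower xp0 d0 bz0 az).
  by exists th => // delta x z _; exact: h.
move=> a; rewrite hz0 => az; apply: (loc (fun y => is_true (y < a%:E)%E)).
case: ltP bz0 => _ bz0; first exact: (hitting_time0_upper cb rb xp0 d0 bz0 az).
exact: (hitting_time0_upper cNb rNb xp0 d0 bz0 az).
Unshelve. all: by end_near.
Qed.

End ZetaContinuity.

(** * The reversed Euler chain *)

Section ChainComparison.
Variable R : realType.
Notation mu := (@lebesgue_measure R).

(** One Euler step, of size [h], of the time-reversed equation with drift
  [1 / (2 v)]. The drift is evaluated [2 * omega] above the current position,
  which only makes it smaller, and the chain is frozen below [rho]. *)
Definition euler_step (h rho omega x xi : R) :=
  if x < rho then x else x + xi + h / (2 * (x + 2 * omega)).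

Fixpoint euler_chain (h rho omega y : R) (xi : nat -> R) (k : nat) : R :=
  if k is k'.+1 then
    euler_step h rho omega (euler_chain h rho omega y xi k') (xi k')
  else y.

Lemma euler_chain_alive h rho omega y xi N k : (k <= N)%N ->
  rho <= euler_chain h rho omega y xi N -> rho <= euler_chain h rho omega y xi k.
Proof.
elim: N => [|N IHN]; first by rewrite leqn0 => /eqP ->.
rewrite leq_eqVlt => /predU1P[->//|]; rewrite ltnS => kN rN; apply: IHN => //.
by move: rN; rewrite /= /euler_step; case: ifPn => //; rewrite -leNgt.
Qed.

Lemma euler_drift_mono (h rho omega x x' : R) : 0 < rho -> 0 <= omega ->
  h <= 2 * rho ^+ 2 -> rho <= x -> x <= x' ->
  x + h / (2 * (x + 2 * omega)) <= x' + h / (2 * (x' + 2 * omega)).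
Proof.
move=> rho0 o0 hr rx xx'.
have p : 0 < x + 2 * omega by lra.
have p' : 0 < x' + 2 * omega by lra.
rewrite -subr_ge0.
have -> : x' + h / (2 * (x' + 2 * omega)) - (x + h / (2 * (x + 2 * omega))) =
    (x' - x) * (2 * ((x + 2 * omega) * (x' + 2 * omega)) - h) /
      (2 * ((x + 2 * omega) * (x' + 2 * omega))).
  by field; rewrite !gt_eqF.
rewrite divr_ge0 ?mulr_ge0 ?subr_ge0 ?(ltW p) ?(ltW p')//.
apply: le_trans hr _; rewrite ler_pM2l// expr2.
by apply: ler_pM; lra.
Qed.

(** Read backwards from [T], a solution rises by at most [2 * omega] over one step
  (half from [b], half from its own drift), so as [1 / 2 <= c] its drift is at
  least the one of the chain. *)
Lemma euler_chain_comparison (b : R -> R) (T y C rho omega : R) (N : nat) c x z :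
  let h := T / N%:R in
  0 < T -> (0 < N)%N -> 0 < rho -> 0 < omega -> omega <= rho / 2 ->
  C * h <= rho * omega / 2 -> h <= 2 * rho ^+ 2 ->
  (forall u v, 0 <= u <= T -> 0 <= v <= T -> `|u - v| <= h ->
     `|b u - b v| <= omega) ->
  1 / 2 <= c <= C -> positive_solution b c x z T -> y <= z T ->
  rho <= euler_chain h rho omega y
    (fun k => - (b ((N - k.+1).+1%:R * h) - b ((N - k.+1)%:R * h))) N ->
  forall s, 0 <= s <= T -> rho / 2 <= z s.
Proof.
move=> h T0 N0 rho0 o0 orho Ch hrho osc /andP[c2 cC] pz yz rN.
set xi := fun k => _ in rN.
have Np : 0 < N%:R :> R by rewrite ltr0n.
have h0 : 0 < h by rewrite divr_gt0.
have Nh : N%:R * h = T by rewrite /h mulrC divfK// gt_eqF.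
have X_ge k : (k <= N)%N -> rho <= euler_chain h rho omega y xi k.
  by move=> kN; exact: euler_chain_alive kN rN.
have [_ zp _] := pz.
have intge0 u v : 0 <= u -> v <= T -> 0 <= c * \int[mu]_(r in `[u, v]) (z r)^-1.
  move=> u0 vT; apply: mulr_ge0; first by lra.
  apply: Rintegral_ge0 => r; rewrite /= in_itv/= => /andP[r0 rT].
  by rewrite invr_ge0 ltW// zp// (le_trans u0 r0) (le_trans rT).
have down u v : 0 <= u -> u <= v -> v <= T -> v - u <= h -> z v - omega <= z u.
  move=> u0 uv vT vuh.
  have ob : `|b v - b u| <= omega.
    apply: osc; first by rewrite vT andbT (le_trans u0).
      by rewrite u0 (le_trans uv).
    by rewrite ger0_norm ?subr_ge0.
  have {}ob : b v - b u <= omega by rewrite (le_trans (ler_norm _)).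
  move: (intge0 u v u0 vT) (positive_solution_incr pz u0 uv vT).
  set S := c * _ => S0 E.
  by clear -ob S0 E; lra.
have step k : (k <= N)%N -> euler_chain h rho omega y xi k <= z ((N - k)%:R * h).
  elim: k => [|k IHk] kN; first by rewrite /= subn0 Nh.
  have {}IHk := IHk (ltnW kN).
  have Xk := X_ge k (ltnW kN).
  set j := (N - k.+1)%N.
  have jE : (N - k = j.+1)%N by rewrite /j subnSK.
  rewrite jE in IHk; rewrite /= /euler_step ltNge Xk/=.
  set X := euler_chain _ _ _ _ _ _ in IHk Xk *.
  have [u uE] : exists u, u = j%:R * h by exists (j%:R * h).
  have [v vE] : exists v, v = j.+1%:R * h by exists (j.+1%:R * h).
  rewrite -uE; rewrite -vE in IHk.
  have vu : v = u + h by rewrite uE vE -natr1 mulrDl mul1r.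
  have u0 : 0 <= u by rewrite uE mulr_ge0// ltW.
  have uv : u <= v by rewrite vu lerDl ltW.
  have vT : v <= T.
    by rewrite vE -Nh ler_pM2r// ler_nat -jE leq_subr.
  have vuh : v - u <= h by rewrite vu addrAC subrr add0r.
  have zlow r : u <= r <= v -> rho / 2 <= z r.
    move=> /andP[ur rv]; have := down r v (le_trans u0 ur) rv vT.
    have : v - r <= h by rewrite (le_trans _ vuh)// lerD2l lerN2.
    move=> rh /(_ rh); lra.
  have zup r : u <= r <= v -> z r <= z v + 2 * omega.
    move=> /andP[ur rv]; have r0 := le_trans u0 ur.
    have ob : `|b v - b r| <= omega.
      apply: osc; first by rewrite vT andbT (le_trans u0).
        by rewrite r0 (le_trans rv).
      by rewrite ger0_norm ?subr_ge0// (le_trans _ vuh)// lerD2l lerN2.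
    have {}ob : - omega <= b v - b r by move: ob; rewrite ler_norml => /andP[].
    have I1 : \int[mu]_(q in `[r, v]) (z q)^-1 <= (rho / 2)^-1 * (v - r).
      apply: Rintegral_segment_le => //; first exact: (positive_solution_intS pz).
      move=> q /andP[rq qv]; have ql : rho / 2 <= z q.
        by apply: zlow; rewrite qv (le_trans ur).
      by rewrite lef_pV2// posrE; lra.
    have I2 : c * \int[mu]_(q in `[r, v]) (z q)^-1 <= omega.
      apply: (@le_trans _ _ (C * ((rho / 2)^-1 * h))).
        apply: ler_pM => //; first by lra.
          apply: Rintegral_ge0 => q; rewrite /= in_itv/= => /andP[rq qv].
          by rewrite invr_ge0 ltW// zp// (le_trans r0 rq) (le_trans qv).
        apply: le_trans I1 _; rewrite ler_wpM2l ?invr_ge0//; first by lra.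
        by rewrite (le_trans _ vuh)// lerD2l lerN2.
      rewrite mulrCA ler_pdivrMl ?divr_gt0//; lra.
    move: I2 (positive_solution_incr pz r0 rv vT).
    set S := c * _ => S0 E.
    by clear -ob S0 E; lra.
  have v0 := le_trans u0 uv.
  have zv : rho <= z v by exact: le_trans IHk.
  have W0 : 0 < z v + 2 * omega by lra.
  have I1 : (z v + 2 * omega)^-1 * (v - u) <= \int[mu]_(q in `[u, v]) (z q)^-1.
    apply: Rintegral_segment_ge => //; first exact: (positive_solution_intS pz).
    move=> r rv; rewrite lef_pV2 ?posrE//; first exact: zup.
    by apply: lt_le_trans (zlow _ rv); lra.
  have I2 : h / (2 * (z v + 2 * omega)) <= c * \int[mu]_(q in `[u, v]) (z q)^-1.
    apply: (@le_trans _ _ (1 / 2 * ((z v + 2 * omega)^-1 * (v - u)))).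
      have -> : v - u = h by rewrite vu addrAC subrr add0r.
      rewrite le_eqVlt; apply/orP; left; apply/eqP; field.
      by rewrite gt_eqF.
    by apply: ler_pM => //; rewrite mulr_ge0 ?invr_ge0 ?subr_ge0// ltW.
  have dm := euler_drift_mono rho0 (ltW o0) hrho Xk IHk.
  have xiE : xi k = - (b v - b u) by rewrite uE vE.
  rewrite xiE; move: I2 (positive_solution_incr pz u0 uv vT).
  set S := c * _ => S0 E.
  by clear -dm S0 E; lra.
move=> s /andP[s0 sT].
have q0 : 0 <= (T - s) / h by rewrite divr_ge0 ?subr_ge0// ltW.
have /andP[k1 k2] := truncn_itv q0; set k := Num.truncn _ in k1 k2.
rewrite ler_pdivlMr// in k1; rewrite ltr_pdivrMr// in k2.
have kN : (k <= N)%N.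
  rewrite -(ler_nat R) -(ler_pM2r h0) Nh (le_trans k1)//; lra.
have [v vE] : exists v, v = (N - k)%:R * h by exists ((N - k)%:R * h).
have vT : v = T - k%:R * h by rewrite vE natrB// mulrBl Nh.
have zv : rho <= z v by rewrite vE (le_trans (X_ge _ kN))// step.
have kh0 : 0 <= k%:R * h by rewrite mulr_ge0// ltW.
rewrite -natr1 mulrDl mul1r in k2.
have := down s v s0; rewrite vT.
have g1 : s <= T - k%:R * h by lra.
have g2 : T - k%:R * h <= T by lra.
have g3 : T - k%:R * h - s <= h by lra.
by move=> /(_ g1 g2 g3); rewrite -vT; lra.
Qed.

End ChainComparison.

(** * Gaussian integrals *)

Section GaussianIntegrals.
Variable R : realType.
Notation mu := (@lebesgue_measure R).

(** [normal_prob] is defined by its density, which therefore is its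
  Radon-Nikodym derivative almost everywhere. *)
Lemma ge0_integral_normal (m s : R) (f : R -> \bar R) :
  measurable_fun [set: R] f -> (forall x, 0 <= f x)%E ->
  (\int[normal_prob m s]_x f x = \int[mu]_x (f x * (normal_pdf m s x)%:E))%E.
Proof.
move=> mf f0; have dom := normal_prob_dominates m s.
rewrite -(Radon_Nikodym_SigmaFinite.change_of_variables dom)//.
have mg : measurable_fun [set: R]
    (Radon_Nikodym_SigmaFinite.f (normal_prob m s) mu).
  exact: measurable_int (Radon_Nikodym_SigmaFinite.f_integrable dom).
have mp : measurable_fun [set: R] (EFin \o normal_pdf m s).
  by apply/measurable_EFinP; exact: measurable_normal_pdf.
apply: ae_eq_integral => //.
- exact: emeasurable_funM.
- exact: emeasurable_funM.
apply: ae_eqe_mul2l; apply: integral_ae_eq => //.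
- exact: Radon_Nikodym_SigmaFinite.f_integrable.
- by move=> A _ mA; rewrite -Radon_Nikodym_SigmaFinite.f_integral.
Qed.

(** Completing the square turns [expR (l * x)] times the centred density into a
  constant times the density with mean [l * s ^+ 2]. *)
Lemma normal_mgf (s l : R) : 0 < s ->
  (\int[normal_prob 0 s]_x (expR (l * x))%:E = (expR (l ^+ 2 * s ^+ 2 / 2))%:E)%E.
Proof.
move=> s0; have sn0 : s != 0 by rewrite gt_eqF.
have me : measurable_fun [set: R] (fun x : R => expR (l * x)).
  by apply: measurableT_comp => //; exact: measurable_funM.
rewrite ge0_integral_normal; last 2 first.
- by apply/measurable_EFinP; exact: me.
- by move=> x; rewrite lee_fin expR_ge0.
transitivity (\int[mu]_x ((expR (l ^+ 2 * s ^+ 2 / 2))%:E *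
    (normal_pdf (l * s ^+ 2) s x)%:E))%E.
  apply: eq_integral => x _; rewrite -!EFinM; congr EFin.
  rewrite !normal_pdfE//= /normal_fun.
  rewrite mulrCA [RHS]mulrCA -!expRD; congr (_ * expR _).
  by rewrite subr0; field.
rewrite integralZl//; last exact: integrable_normal_pdf.
by rewrite integral_normal_pdf mule1.
Qed.

(** Combinations of exponentials are integrated exactly by [normal_mgf]; they
  serve to bound the moments of the normal distribution. *)
Definition exp_comb (a : seq (R * R)) x := \sum_(p <- a) p.1 * expR (p.2 * x).

Lemma normal_exp_comb (s : R) (a : seq (R * R)) : 0 < s ->
  (normal_prob 0 s).-integrable [set: R] (EFin \o exp_comb a) /\
  (\int[normal_prob 0 s]_x (exp_comb a x)%:E =
    (\sum_(p <- a) p.1 * expR (p.2 ^+ 2 * s ^+ 2 / 2))%:E)%E.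
Proof.
move=> s0; have ie l : (normal_prob 0 s).-integrable [set: R]
    (EFin \o (fun x : R => expR (l * x))).
  apply/integrableP; split.
    apply/measurable_EFinP; apply: measurableT_comp => //; exact: measurable_funM.
  apply: (@le_lt_trans _ _ (\int[normal_prob 0 s]_x (expR (l * x))%:E)%E).
    rewrite le_eqVlt; apply/orP; left; apply/eqP; apply: eq_integral => x _.
    by rewrite /= ger0_norm ?expR_ge0.
  by rewrite normal_mgf// ltry.
elim: a => [|[k l] a [IHi IHv]].
  have E0 : EFin \o exp_comb [::] = cst 0%E.
    by apply/funext => x; rewrite /= /exp_comb big_nil.
  rewrite big_nil; split; first by rewrite E0; exact: integrable0.
  transitivity (\int[normal_prob 0 s]_x (0 : \bar R))%E; last by rewrite integral0.
  by apply: eq_integral => x _; rewrite /exp_comb big_nil.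
have EE : EFin \o exp_comb ((k, l) :: a) =
    ((fun x => k%:E * (EFin \o (fun x : R => expR (l * x)%R)) x) \+
      (EFin \o exp_comb a))%E.
  by apply/funext => x; rewrite /= /exp_comb big_cons.
have i1 := integrableZl measurableT k (ie l).
split; first by rewrite EE; exact: integrableD.
transitivity (\int[normal_prob 0 s]_x (k%:E * (expR (l * x))%:E + (exp_comb a x)%:E))%E.
  by apply: eq_integral => x _; rewrite /exp_comb big_cons EFinD EFinM.
rewrite (integralD measurableT i1 IHi).
by rewrite (integralZl _ (ie l))//= normal_mgf// IHv big_cons.
Qed.

Lemma expR_le_quad (u : R) : 0 <= u <= 1 / 2 -> expR u <= 1 + u + 2 * u ^+ 2.
Proof.
move=> /andP[u0 u2]; have := expR_ge1Dx (- u); rewrite expRN => h.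
have e0 := expR_gt0 u.
have {}h : (1 - u) * expR u <= 1 by rewrite -ler_pdivlMr// mul1r.
have : (1 - u) * expR u <= (1 - u) * (1 + u + 2 * u ^+ 2).
  apply: le_trans h _; rewrite -subr_ge0.
  have -> : (1 - u) * (1 + u + 2 * u ^+ 2) - 1 = u ^+ 2 * (1 - 2 * u) by ring.
  by rewrite mulr_ge0 ?sqr_ge0//; lra.
by rewrite ler_pM2l//; lra.
Qed.

(** The constant in front of the square is optimal, which matters for the second
  moment: the critical dimension 2 leaves no room at first order in [h]. *)
Lemma sqr_le_expR (u : R) : u ^+ 2 <= expR u + expR (- u) - 2.
Proof.
have sinh (w : R) : 0 <= w -> 2 * w <= expR w - expR (- w).
  move=> w0; pose g (t : R) := expR t - expR (- t).
  have dg (x : R) : is_derive x (1 : R) g (expR x + expR (- x)).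
    by apply: is_derive_eq; rewrite /GRing.scale/=; ring.
  have cg : {within `[0, w], continuous g}.
    apply: continuous_subspaceT => x; apply: differentiable_continuous.
    exact/derivable1_diffP.
  have [c _] := MVT_segment w0 (fun x _ => dg x) cg.
  have g0 : g 0 = 0 by rewrite /g oppr0 subrr.
  rewrite g0 !subr0 -/(g w) => ->; apply: ler_wpM2r => //.
  by have := expR_ge1Dx c; have := expR_ge1Dx (- c); lra.
have h (w : R) : 0 <= w -> w ^+ 2 <= expR w + expR (- w) - 2.
  move=> w0; have w20 : 0 <= w / 2 by rewrite divr_ge0.
  have := sinh _ w20; rewrite mulrC divfK ?pnatr_eq0// => h.
  have -> : expR w + expR (- w) - 2 = (expR (w / 2) - expR (- (w / 2))) ^+ 2.
    have e1 : expR w = expR (w / 2) ^+ 2.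
      by rewrite expr2 -expRD; congr expR; field.
    have e2 : expR (- w) = expR (- (w / 2)) ^+ 2.
      by rewrite expr2 -expRD; congr expR; field.
    have e3 : expR (w / 2) * expR (- (w / 2)) = 1 by rewrite -expRD subrr expR0.
    by rewrite e1 e2 sqrrB e3; ring.
  by rewrite !expr2; apply: ler_pM.
have [u0|u0] := leP 0 u; first exact: h.
have := h (- u); rewrite oppr_ge0 (ltW u0) => /(_ isT).
by rewrite opprK sqrrN; lra.
Qed.

Lemma pow4_le_expR (u : R) : u ^+ 4 <= 24 * (expR u + expR (- u)).
Proof.
have h (v : R) : 0 <= v -> v ^+ 4 <= 24 * expR v.
  move=> v0; have := expR_ge1Dxn 3 v0.
  have -> : 4`!%:R = 24 :> R by [].
  by lra.
have e1 := expR_ge0 u; have e2 := expR_ge0 (- u).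
have [u0|u0] := leP 0 u; first by have := h u u0; lra.
have := h (- u); rewrite oppr_ge0 (ltW u0) => /(_ isT).
by rewrite (_ : (- u) ^+ 4 = u ^+ 4); [lra|ring].
Qed.

(** The coefficient [1 / 2] of the Taylor expansion is reached up to an
  arbitrarily small [s]; the difference of the two sides has a derivative of the
  sign of its argument on [- s, s]. *)
Lemma ln_ge_quad (s v : R) : 0 < s -> s <= 1 / 2 -> `|v| <= s ->
  v - (1 / 2 + s) * v ^+ 2 <= ln (1 + v).
Proof.
move=> s0 s2 vs; have := vs; rewrite ler_norml => /andP[v1 v2].
pose g (t : R) := ln (1 + t) - t + (1 / 2 + s) * t ^+ 2.
suff : 0 <= g v by rewrite /g; lra.
have dg (x : R) : -1 < x ->
    is_derive x (1 : R) g ((1 + x)^-1 - 1 + (1 + 2 * s) * x).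
  move=> x1; have x1' : 0 < 1 + x by lra.
  have dl := is_derive1_ln x1'.
  have d1 : is_derive x (1 : R) (fun t : R => 1 + t) 1.
    by apply: is_derive_eq; ring.
  have d2 := @is_derive1_comp _ (@ln R) (fun t : R => 1 + t) x _ _ dl d1.
  rewrite /g; apply: is_derive_eq; rewrite /GRing.scale/=. by field; rewrite gt_eqF.
have cg (a b : R) : -1 < a -> {within `[a, b], continuous g}.
  move=> a1; apply: continuous_in_subspaceT => x; rewrite inE/= in_itv/= => /andP[ax _].
  apply: differentiable_continuous; apply/derivable1_diffP.
  by have [] := dg x (lt_le_trans a1 ax).
have g0 : g 0 = 0 by rewrite /g addr0 ln1; ring.
have sgn (x : R) : -s <= x <= s -> 0 <= ((1 + x)^-1 - 1 + (1 + 2 * s) * x) * x.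
  move=> /andP[x1 x2]; have p : 0 < 1 + x by lra.
  have -> : ((1 + x)^-1 - 1 + (1 + 2 * s) * x) * x =
     (2 * s * (1 + x) + x) * x ^+ 2 / (1 + x) by field; rewrite gt_eqF.
  apply: divr_ge0; last exact: ltW.
  apply: mulr_ge0; last exact: sqr_ge0.
  have : 0 <= (1 - 2 * s) * s by rewrite mulr_ge0//; lra.
  have : 0 <= (x + s) * (2 * s) by rewrite mulr_ge0//; lra.
  nra.
have A0 : (1 + 0)^-1 - 1 + (1 + 2 * s) * 0 = 0 by rewrite addr0 invr1; ring.
have [v0|v0] := leP 0 v.
  have dv (x : R) : x \in `]0, v[ -> is_derive x (1 : R) g ((1 + x)^-1 - 1 + (1 + 2 * s) * x).
    by rewrite in_itv/= => /andP[x0 xv]; apply: dg; lra.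
  have [c + E] := MVT_segment v0 dv (cg 0 v ltac:(lra)).
  rewrite in_itv/= => /andP[c0 cv]; move: E; rewrite g0 !subr0 => E.
  rewrite E.
  have := sgn c; rewrite (le_trans cv v2) (le_trans _ c0) ?oppr_le0 ?(ltW s0)// => /(_ isT).
  have [cE|cn0] := eqVneq c 0; first by rewrite cE A0 !mul0r.
  by rewrite pmulr_lge0 ?lt_neqAle 1?eq_sym ?cn0// => h; rewrite mulr_ge0.
have dv (x : R) : x \in `]v, 0[ -> is_derive x (1 : R) g ((1 + x)^-1 - 1 + (1 + 2 * s) * x).
  by rewrite in_itv/= => /andP[x0 xv]; apply: dg; lra.
have [c + E] := MVT_segment (ltW v0) dv (cg v 0 ltac:(lra)).
rewrite in_itv/= => /andP[vc c0]; move: E; rewrite g0 sub0r sub0r => E.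
have {E} -> : g v = ((1 + c)^-1 - 1 + (1 + 2 * s) * c) * v.
  by apply: oppr_inj; rewrite E mulrN.
have := sgn c; rewrite (le_trans v1 vc) (le_trans c0 (ltW s0)) => /(_ isT).
have [cE|cn0] := eqVneq c 0; first by rewrite cE A0 !mul0r.
by rewrite nmulr_lge0 ?lt_neqAle ?cn0// => h; rewrite nmulr_lge0.
Qed.

End GaussianIntegrals.

(** * The Lyapunov function *)

Section Lyapunov.
Variable R : realType.
Notation mu := (@lebesgue_measure R).

(** Up to an error of order [h ^+ 2], the mean of a quartic polynomial is computed
  with first moment 0 and second moment [h]. *)
Lemma normal_quartic_le (h A B C D : R) (f : R -> R) : 0 < h -> h <= 1 ->
  0 <= C -> 0 <= D -> measurable_fun [set: R] f -> (forall x, 0 <= f x) ->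
  (forall x, f x <= A + B * x + C * x ^+ 2 + D * x ^+ 4) ->
  (\int[normal_prob 0 (Num.sqrt h)]_x (f x)%:E <=
    (A + h ^+ 2 + C * (h + h ^+ 2) + 96 * D * h ^+ 2)%:E)%E.
Proof.
move=> h0 h1 C0 D0 mf f0 fle.
have s0 : 0 < Num.sqrt h by rewrite sqrtr_gt0.
have sh : Num.sqrt h ^+ 2 = h by rewrite sqr_sqrtr// ltW.
set s := Num.sqrt h in s0 sh *.
(* [l] is so small that the linear term, dominated by
   [(expR (l * B * x) - 1) / l], contributes at most [h ^+ 2] *)
pose l := h / (B ^+ 2 + 1).
have B0 : 0 < B ^+ 2 + 1 by rewrite ltr_wpDl// sqr_ge0.
have l0 : 0 < l by rewrite divr_gt0.
pose E := 24 * D * h ^+ 2.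
have E0 : 0 <= E by rewrite !mulr_ge0// ltW.
pose a := [:: (A - l^-1 - 2 * C, 0); (l^-1, l * B); (C, 1); (C, -1);
  (E, s^-1); (E, - s^-1)].
have [ia va] := normal_exp_comb a s0.
have combE x : exp_comb a x = A - l^-1 - 2 * C + l^-1 * expR (l * B * x) +
    C * (expR x + expR (- x)) + E * (expR (x / s) + expR (- (x / s))).
  rewrite /exp_comb /a !big_cons big_nil /=.
  by rewrite mul0r expR0 mul1r mulN1r mulNr (mulrC s^-1); ring.
have fcomb x : f x <= exp_comb a x.
  apply: le_trans (fle x) _; rewrite combE.
  have t1 : B * x <= l^-1 * expR (l * B * x) - l^-1.
    have : l^-1 * (1 + l * B * x) <= l^-1 * expR (l * B * x).
      by rewrite ler_pM2l ?invr_gt0// expR_ge1Dx.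
    have -> : l^-1 * (1 + l * B * x) = l^-1 + B * x by field; rewrite gt_eqF.
    lra.
  have t2 : C * x ^+ 2 <= C * (expR x + expR (- x)) - 2 * C.
    have : C * x ^+ 2 <= C * (expR x + expR (- x) - 2).
      by rewrite ler_wpM2l// sqr_le_expR.
    lra.
  have t3 : D * x ^+ 4 <= E * (expR (x / s) + expR (- (x / s))).
    have -> : x ^+ 4 = h ^+ 2 * (x / s) ^+ 4.
      by rewrite -sh; field; rewrite gt_eqF.
    rewrite mulrA (_ : E * _ =
      D * h ^+ 2 * (24 * (expR (x / s) + expR (- (x / s))))); last by rewrite /E; ring.
    apply: ler_wpM2l; last exact: pow4_le_expR.
    by apply: mulr_ge0; last exact: sqr_ge0.
  lra.
apply: (@le_trans _ _ (\int[normal_prob 0 s]_x (exp_comb a x)%:E)%E).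
  apply: ge0_le_integral => //.
  - by move=> x _; rewrite lee_fin.
  - by apply/measurable_EFinP.
  - exact: (measurable_int _ ia).
  - by move=> x _; rewrite lee_fin.
rewrite va lee_fin /a !big_cons big_nil /= sh.
have u1 : l^-1 * expR ((l * B) ^+ 2 * h / 2) <= l^-1 + h ^+ 2.
  set u := (l * B) ^+ 2 * h / 2.
  have u0 : 0 <= u by rewrite /u divr_ge0// mulr_ge0 ?sqr_ge0// ltW.
  have lB : l * B ^+ 2 <= h.
    by rewrite /l mulrAC ler_pdivrMr// ler_wpM2l ?ltW// ltrDl.
  have uE : u = l * B ^+ 2 * (l * h) / 2 by rewrite /u; field.
  have lh : l <= h.
    by rewrite /l ler_pdivrMr// ler_peMr ?(ltW h0)// lerDr sqr_ge0.
  have ul : u <= h * (l * h) / 2.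
    by rewrite uE ler_pM2r ?invr_gt0// ler_wpM2r// mulr_ge0// ltW.
  have hh1 : h * h <= 1 by rewrite mulr_ile1// ltW.
  have hlh : h * (l * h) <= 1.
    rewrite mulrCA mulr_ile1 ?(ltW l0)// ?mulr_ge0 ?(ltW h0)//.
    exact: le_trans h1.
  have u2 : u <= 1 / 2 by lra.
  have := expR_le_quad (u := u); rewrite u0 u2 => /(_ isT) eu.
  have {}eu : expR u <= 1 + 2 * u.
    have : u * u <= u * (1 / 2) by rewrite ler_wpM2l.
    by rewrite expr2 in eu; lra.
  have -> : l^-1 + h ^+ 2 = l^-1 * (1 + l * h ^+ 2) by field; rewrite gt_eqF.
  rewrite ler_pM2l ?invr_gt0//; apply: le_trans eu _.
  by rewrite lerD2l expr2; lra.
have u2 : expR (1 ^+ 2 * h / 2) <= 1 + (h + h ^+ 2) / 2.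
  have := expR_le_quad (u := 1 ^+ 2 * h / 2).
  have -> : 0 <= 1 ^+ 2 * h / 2 <= 1 / 2.
    by rewrite expr1n mul1r; apply/andP; split; lra.
  by move=> /(_ isT) /le_trans; apply; rewrite expr1n mul1r; lra.
have u3 : expR (s^-1 ^+ 2 * h / 2) <= 2.
  have -> : s^-1 ^+ 2 * h / 2 = 1 / 2.
    by rewrite -sh; field; rewrite gt_eqF.
  have h12 : 0 <= (1 / 2 : R) <= 1 / 2 by apply/andP; split; lra.
  by have := expR_le_quad h12; lra.
rewrite !sqrrN !expr0n/= !mul0r expR0 mulr1.
have v2 : C * expR (1 ^+ 2 * h / 2) <= C * (1 + (h + h ^+ 2) / 2).
  by rewrite ler_wpM2l.
have v3 : E * expR (s^-1 ^+ 2 * h / 2) <= E * 2 by rewrite ler_wpM2l.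
have EE : E * 4 = 96 * D * h ^+ 2 by rewrite /E; ring.
lra.
Qed.

(** For the Bessel process of dimension 2, [- ln] is harmonic. The cutoff at [rho / 2] keeps
  it finite, and the square makes it nonnegative at the price of a bounded
  drift. *)
Definition lyapunov (rho x : R) := x ^+ 2 - ln (Num.max x (rho / 2)).

Lemma lyapunov_ge0 (rho x : R) : 0 < rho -> rho <= 2 -> 0 <= lyapunov rho x.
Proof.
move=> r0 r2; rewrite /lyapunov subr_ge0.
have [xr|xr] := leP (rho / 2) x.
  have x0 : 0 < x by lra.
  have : 0 <= (x - 1 / 2) ^+ 2 by exact: sqr_ge0.
  have := le_ln1Dx (x := x - 1); rewrite subrKC => h.
  have : ln x <= x - 1 by apply: h; lra.
  rewrite sqrrB; lra.
by rewrite (le_trans (ln_le0 _)) ?sqr_ge0//; lra.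
Qed.

Lemma measurable_lyapunov rho : measurable_fun [set: R] (lyapunov rho).
Proof.
apply: measurable_funB; first exact: exprn_measurable.
apply: measurableT_comp; first exact: measurable_ln.
exact: measurable_maxr.
Qed.

(** For [D] small with respect to [x] this is [ln_ge_quad]; otherwise the cutoff
  bounds the left-hand side and the quartic term dominates. *)
Lemma lyapunov_taylor (rho : R) (s := rho ^+ 2 / 2) : 0 < rho -> rho <= 1 ->
  exists2 K, 0 <= K & forall x D, rho <= x ->
    lyapunov rho (x + D) <= lyapunov rho x + (2 * x - x^-1) * D +
      (1 + (1 / 2 + s) / x ^+ 2) * D ^+ 2 + K * D ^+ 4.
Proof.
move=> r0 r1; have s0 : 0 < s by rewrite divr_gt0// exprn_gt0.
have s2 : s <= 1 / 2 by rewrite /s ler_pM2r ?invr_gt0// exprn_ile1// ltW.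
have rs0 : 0 < rho ^+ 4 * s ^+ 4 by rewrite mulr_gt0// exprn_gt0.
pose K := 5 / 2 / (rho ^+ 4 * s ^+ 4).
have K0 : 0 < K by rewrite divr_gt0.
exists K; first exact: ltW.
move=> x D rx; have x0 : 0 < x by lra.
have D4 : 0 <= D ^+ 4 by rewrite (_ : D ^+ 4 = (D ^+ 2) ^+ 2) ?sqr_ge0//; ring.
pose v := D / x; have DE : D = x * v by rewrite /v mulrC divfK// gt_eqF.
suff lnle : - ln (Num.max (x + D) (rho / 2)) <=
    - ln x - v + (1 / 2 + s) * v ^+ 2 + K * D ^+ 4.
  rewrite /lyapunov (_ : Num.max x (rho / 2) = x); last first.
    by apply/max_idPl; lra.
  have -> : (2 * x - x^-1) * D = 2 * x * D - v by rewrite /v; ring.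
  have -> : (1 + (1 / 2 + s) / x ^+ 2) * D ^+ 2 = D ^+ 2 + (1 / 2 + s) * v ^+ 2.
    by rewrite /v; field; rewrite gt_eqF.
  rewrite sqrrD; lra.
have KD0 : 0 <= K * D ^+ 4 by rewrite mulr_ge0// ltW.
have [vs|vs] := leP `|v| s.
  have := ln_ge_quad s0 s2 vs.
  have v1 : - (1 / 2) <= v by have := vs; rewrite ler_norml => /andP[]; lra.
  have xD : x + D = x * (1 + v) by rewrite DE; ring.
  have x2 : x * (1 / 2) <= x + D by rewrite xD ler_pM2l//; lra.
  rewrite (_ : Num.max _ _ = x + D); last by apply/max_idPl; lra.
  rewrite xD lnM ?posrE//; last by lra.
  lra.
have mx : rho / 2 <= Num.max (x + D) (rho / 2) by rewrite le_max lexx orbT.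
have r20 : 0 < rho / 2 by lra.
have lnm : ln (rho / 2) <= ln (Num.max (x + D) (rho / 2)).
  by rewrite ler_ln ?posrE// (lt_le_trans r20).
have lnx : ln x - ln (rho / 2) <= 2 * x / rho.
  rewrite -ln_div ?posrE//.
  have -> : x / (rho / 2) = 2 * x / rho by field; rewrite gt_eqF.
  by rewrite ltW// ln_sublinear// divr_gt0// mulr_gt0.
have KD : 2 * x / rho + 1 / 2 <= K * D ^+ 4.
  have v4 : s ^+ 4 <= v ^+ 4.
    have -> : v ^+ 4 = `|v| ^+ 4.
      by rewrite -[4%N]/(2 * 2)%N !exprM real_normK ?num_real.
    by rewrite lerXn2r ?nnegrE// ltW.
  have x4 : rho ^+ 4 * (1 / 2 + 2 * x / rho) <= 5 / 2 * x ^+ 4.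
    have h3 : rho ^+ 3 <= x ^+ 3 by rewrite lerXn2r ?nnegrE// ltW.
    have h4 : rho ^+ 4 <= x ^+ 4 by rewrite lerXn2r ?nnegrE// ltW.
    have -> : rho ^+ 4 * (1 / 2 + 2 * x / rho) = rho ^+ 4 / 2 + 2 * (rho ^+ 3 * x).
      by field; rewrite gt_eqF.
    have : rho ^+ 3 * x <= x ^+ 3 * x by rewrite ler_pM2r.
    by rewrite -exprSr; lra.
  have -> : K * D ^+ 4 = (5 / 2 * x ^+ 4) / rho ^+ 4 * (v ^+ 4 / s ^+ 4).
    by rewrite DE /K; field; rewrite !gt_eqF.
  apply: (@le_trans _ _ ((5 / 2 * x ^+ 4) / rho ^+ 4)).
    by rewrite ler_pdivlMr ?exprn_gt0// addrC mulrC.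
  apply: ler_peMr.
    apply: divr_ge0; last by apply: exprn_ge0; exact: ltW.
    by apply: mulr_ge0; [lra|apply: exprn_ge0; exact: ltW].
  by rewrite ler_pdivlMr ?exprn_gt0// mul1r.
have : 0 <= (v - 1) ^+ 2 by exact: sqr_ge0.
have : 0 <= s * v ^+ 2 by rewrite mulr_ge0 ?sqr_ge0// ltW.
rewrite sqrrB; lra.
Qed.

(** At first order in [h] the contributions of [- ln x] are [- h / (2 x (x + 2
  omega))] from the drift and [h / (2 x ^+ 2)] from the variance of the noise,
  and they cancel up to a term controlled by [omega]; the square contributes at
  most [2 h]. The other terms are of order [h ^+ 2]. *)
Lemma euler_step_lyapunov (rho : R) : 0 < rho -> rho <= 1 ->
  exists2 h0, 0 < h0 & forall h omega sg x, 0 < h -> h <= h0 -> 0 < omega ->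
    omega <= rho ^+ 3 / 2 -> sg ^+ 2 = 1 ->
    (\int[normal_prob 0 (Num.sqrt h)]_xi
       (lyapunov rho (euler_step h rho omega x (sg * xi)))%:E <=
     (lyapunov rho x + 4 * h)%:E)%E.
Proof.
move=> r0 r1; have [K K0 tay] := lyapunov_taylor r0 r1.
set s := rho ^+ 2 / 2 in tay.
have s2 : s <= 1 / 2 by rewrite /s ler_pM2r ?invr_gt0// exprn_ile1// ltW.
have s0 : 0 < s by rewrite divr_gt0// exprn_gt0.
pose Q := rho^-1; pose C1 := 1 + Q ^+ 2.
have Q0 : 0 < Q by rewrite invr_gt0.
have C10 : 0 <= C1 by rewrite addr_ge0// sqr_ge0.
pose W := C1 * Q ^+ 2 + 8 * K * Q ^+ 4 + 1 + C1 + 768 * K.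
have W1 : 1 <= W.
  have w1 : 0 <= C1 * Q ^+ 2 by rewrite mulr_ge0 ?sqr_ge0.
  have w2 : 0 <= 8 * K * Q ^+ 4 by rewrite !mulr_ge0 ?exprn_ge0// ltW.
  by rewrite /W; lra.
have W0 : 0 < W by lra.
exists W^-1; first by rewrite invr_gt0.
move=> h omega sg x h0 hW o0 or sg2.
have h1 : h <= 1 by rewrite (le_trans hW)// invf_le1.
have hW1 : h * W <= 1 by rewrite -ler_pdivlMr// mul1r.
have [xr|rx] := ltP x rho.
  rewrite /euler_step xr integral_cst//.
  rewrite [X in (_ * X)%E](probability_setT (normal_prob 0 (Num.sqrt h))) mule1 lee_fin.
  by rewrite lerDl mulr_ge0// ltW.
have x0 : 0 < x by lra.
have xo : 0 < x + 2 * omega by lra.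
pose q := h / (2 * (x + 2 * omega)).
have q0 : 0 < q by rewrite divr_gt0// mulr_gt0.
pose C0 := 1 + (1 / 2 + s) / x ^+ 2.
have C00 : 0 <= C0.
  by apply: addr_ge0 => //; apply: divr_ge0; [lra|exact: sqr_ge0].
have xQ : x^-1 <= Q by rewrite lef_pV2 ?posrE.
have xV0 : 0 <= x^-1 by rewrite invr_ge0 ltW.
have C01 : C0 <= C1.
  rewrite lerD2l; apply: (@le_trans _ _ (1 * (x^-1) ^+ 2)).
    by rewrite -exprVn ler_wpM2r ?sqr_ge0//; lra.
  by rewrite mul1r lerXn2r ?nnegrE// ltW.
have qQ : q <= h * Q.
  rewrite /q ler_pM2l// lef_pV2 ?posrE ?mulr_gt0//; lra.
have step xi : lyapunov rho (euler_step h rho omega x (sg * xi)) <=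
    (lyapunov rho x + (2 * x - x^-1) * q + C0 * q ^+ 2 + 8 * K * q ^+ 4) +
    (sg * (2 * x - x^-1 + 2 * q * C0)) * xi + C0 * xi ^+ 2 + 8 * K * xi ^+ 4.
  rewrite /euler_step ltNge rx/= -/q -addrA.
  apply: le_trans (tay _ _ rx) _; rewrite -/C0.
  have p2 : (sg * xi + q) ^+ 2 = xi ^+ 2 + 2 * q * sg * xi + q ^+ 2.
    by rewrite sqrrD exprMn sg2; ring.
  have p4 : (sg * xi + q) ^+ 4 <= 8 * xi ^+ 4 + 8 * q ^+ 4.
    have w4 : (sg * xi) ^+ 4 = xi ^+ 4.
      by rewrite exprMn -[in sg ^+ 4](_ : (2 * 2)%N = 4%N)// exprM sg2 expr1n mul1r.
    rewrite -w4; set w := sg * xi; rewrite -subr_ge0.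
    have -> : 8 * w ^+ 4 + 8 * q ^+ 4 - (w + q) ^+ 4 =
        (w - q) ^+ 2 * (7 * w ^+ 2 + 10 * w * q + 7 * q ^+ 2) by ring.
    rewrite mulr_ge0 ?sqr_ge0//.
    have -> : 7 * w ^+ 2 + 10 * w * q + 7 * q ^+ 2 =
       5 * (w + q) ^+ 2 + 2 * w ^+ 2 + 2 * q ^+ 2 by ring.
    have := sqr_ge0 (w + q); have := sqr_ge0 w; have := sqr_ge0 q; lra.
  have Kp4 : K * (sg * xi + q) ^+ 4 <= K * (8 * xi ^+ 4 + 8 * q ^+ 4).
    by rewrite ler_wpM2l.
  rewrite p2; lra.
have mstep : measurable_fun [set: R]
    (fun xi => lyapunov rho (euler_step h rho omega x (sg * xi))).
  apply: measurableT_comp; first exact: measurable_lyapunov.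
  rewrite /euler_step ltNge rx/=.
  apply: measurable_funD; last exact: measurable_cst.
  apply: measurable_funD; first exact: measurable_cst.
  by apply: measurable_funM.
have r2 : rho <= 2 by lra.
have K8 : 0 <= 8 * K by rewrite mulr_ge0.
apply: le_trans (normal_quartic_le h0 h1 C00 K8 mstep
  (fun xi => lyapunov_ge0 _ r0 r2) step) _.
rewrite lee_fin.
have e1 : 2 * x * q <= h.
  have -> : 2 * x * q = h * (x / (x + 2 * omega)).
    by rewrite /q; field; rewrite gt_eqF.
  by rewrite ler_piMr ?(ltW h0)// ler_pdivrMr// mul1r; lra.
have e2 : C0 * h - x^-1 * q <= 2 * h.
  have -> : C0 * h - x^-1 * q =
      h + h * (omega * x^-1 * x^-1 / (x + 2 * omega)) + h * (s * (x^-1) ^+ 2).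
    by rewrite /C0 /q; field; rewrite !gt_eqF.
  have f1 : omega * x^-1 * x^-1 / (x + 2 * omega) <= 1 / 2.
    have g1 : x^-1 * x^-1 <= Q * Q by rewrite ler_pM.
    have g2 : (x + 2 * omega)^-1 <= Q by rewrite lef_pV2 ?posrE//; lra.
    have g3 : x^-1 * x^-1 * (x + 2 * omega)^-1 <= Q * Q * Q.
      by rewrite ler_pM ?mulr_ge0 ?invr_ge0// ltW.
    rewrite (_ : omega * x^-1 * x^-1 / (x + 2 * omega) =
      omega * (x^-1 * x^-1 * (x + 2 * omega)^-1)); last by rewrite !mulrA.
    apply: (@le_trans _ _ (rho ^+ 3 / 2 * (Q * Q * Q))).
      apply: ler_pM => //; first exact: ltW.
      by apply: mulr_ge0; [exact: mulr_ge0|rewrite invr_ge0 ltW].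
    by rewrite /Q le_eqVlt; apply/orP; left; apply/eqP; field; rewrite gt_eqF.
  have f2 : s * (x^-1) ^+ 2 <= 1 / 2.
    apply: (@le_trans _ _ (s * Q ^+ 2)).
      by rewrite ler_pM2l// lerXn2r ?nnegrE// ltW.
    by rewrite /s /Q le_eqVlt; apply/orP; left; apply/eqP; field; rewrite gt_eqF.
  have f1' := ler_wpM2l (ltW h0) f1; have f2' := ler_wpM2l (ltW h0) f2.
  lra.
have hh0 : 0 <= h ^+ 2 by exact: sqr_ge0.
have q2 : q ^+ 2 <= h ^+ 2 * Q ^+ 2.
  by rewrite -exprMn lerXn2r ?nnegrE ?(ltW q0)// mulr_ge0// ltW.
have q4 : q ^+ 4 <= h ^+ 2 * Q ^+ 4.
  apply: (@le_trans _ _ ((h * Q) ^+ 4)).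
    by rewrite lerXn2r ?nnegrE ?(ltW q0)// mulr_ge0// ltW.
  rewrite exprMn ler_wpM2r ?exprn_ge0 ?(ltW Q0)//.
  by rewrite -[4%N]/(2 + 2)%N exprD ler_piMr// exprn_ile1// ltW.
have e3 : C0 * q ^+ 2 <= C1 * (h ^+ 2 * Q ^+ 2) by rewrite ler_pM// sqr_ge0.
have e4 : 8 * K * q ^+ 4 <= 8 * K * (h ^+ 2 * Q ^+ 4) by rewrite ler_wpM2l.
have e5 : C0 * h ^+ 2 <= C1 * h ^+ 2 by rewrite ler_wpM2r.
have e6 : C1 * (h ^+ 2 * Q ^+ 2) + 8 * K * (h ^+ 2 * Q ^+ 4) + h ^+ 2 +
    C1 * h ^+ 2 + 96 * (8 * K) * h ^+ 2 <= h.
  apply: (@le_trans _ _ (h * (h * W))).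
    by rewrite /W le_eqVlt; apply/orP; left; apply/eqP; ring.
  by rewrite ler_piMr// ltW.
lra.
Qed.

End Lyapunov.

(** * Expectations of functions of an independent pair *)

Section IndependentPair.
Context (d : measure_display) (T : measurableType d) (R : realType)
  (P : probability T R).

(** The law of [Y] restricted to the event [E]; it has total mass [P E]. *)
Definition law_on d' (T' : measurableType d') (Y : {mfun T >-> T'})
  (E : set T) (mE : measurable E) (A : set T') := P (Y @^-1` A `&` E).

Section LawOn.
Context d' (T' : measurableType d') (Y : {mfun T >-> T'}) (E : set T)
  (mE : measurable E).

Let law0 : law_on Y mE set0 = 0%E.
Proof. by rewrite /law_on preimage_set0 set0I measure0. Qed.

Let law_ge0 A : (0 <= law_on Y mE A)%E.
Proof. exact: measure_ge0. Qed.

Let law_sigma_additive : semi_sigma_additive (law_on Y mE).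
Proof.
move=> F mF tF mU; rewrite /law_on preimage_bigcup setI_bigcupl.
have mYF n : measurable (Y @^-1` F n `&` E).
  by apply: measurableI => //; exact: measurable_funPTI.
apply: measure_semi_sigma_additive => //.
- apply/trivIsetP => i j _ _ ij; rewrite setIACA -preimage_setI.
  by move/trivIsetP : tF => /(_ i j I I ij) ->; rewrite preimage_set0 set0I.
- exact: bigcupT_measurable.
Qed.

HB.instance Definition _ := isMeasure.Build _ _ _ (law_on Y mE)
  law0 law_ge0 law_sigma_additive.

Let law_fin : fin_num_fun (law_on Y mE).
Proof.
move=> A mA; rewrite /law_on fin_num_measure//.
by apply: measurableI => //; exact: measurable_funPTI.
Qed.

HB.instance Definition _ := Measure_isFinite.Build _ _ _ (law_on Y mE) law_fin.

End LawOn.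

Context (d1 d2 : measure_display) (T1 : measurableType d1) (T2 : measurableType d2)
  (X : {mfun T >-> T1}) (D : {mfun T >-> T2}).

Let pair_fun w := (X w, D w).
Let pair_measurable : measurable_fun [set: T] pair_fun.
Proof. exact: measurable_fun_pair. Qed.
Let XD : {mfun T >-> (T1 * T2)%type} := mfun_Sub (mem_set pair_measurable).

Lemma independent_pair_law (E : set T) (mE : measurable E) :
  (forall A B, measurable A -> measurable B ->
    P (X @^-1` A `&` (D @^-1` B `&` E)) = (P (X @^-1` A) * P (D @^-1` B `&` E))%E) ->
  forall S, measurable S ->
    P (pair_fun @^-1` S `&` E) = (distribution P X \x law_on D mE)%E S.
Proof.
move=> ind S mS.
rewrite (@product_measure_unique _ _ _ _ _ _ _ (law_on XD mE))// => A B mA mB.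
by rewrite -[RHS]ind// setIA.
Qed.

(** By independence the joint law of [X] and [D] on the event [E] is a product
  measure, whose second factor is proportional to the law of [D]. *)
Lemma independent_pair_event (E : set T) (mE : measurable E) :
  (forall A B, measurable A -> measurable B ->
    P (X @^-1` A `&` (D @^-1` B `&` E)) =
    (P (X @^-1` A) * (P (D @^-1` B) * P E))%E) ->
  (forall A B, measurable A -> measurable B ->
    P (X @^-1` A `&` D @^-1` B) = (P (X @^-1` A) * P (D @^-1` B))%E) ->
  forall S, measurable S ->
    P (pair_fun @^-1` S `&` E) = (P (pair_fun @^-1` S) * P E)%E.
Proof.
move=> indE ind S mS.
have DE B : measurable B -> P (D @^-1` B `&` E) = (P (D @^-1` B) * P E)%E.
  move=> mB; have := indE setT B measurableT mB.
  by rewrite preimage_setT setTI probability_setT mul1e.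
rewrite (independent_pair_law mE)//; last first.
  by move=> A B mA mB; rewrite indE// DE.
have := independent_pair_law (@measurableT _ T) _ mS.
rewrite setIT => ->; last by move=> A B mA mB; rewrite setIT ind.
rewrite /product_measure1 -ge0_integralZr//; last first.
  exact: measurable_fun_xsection.
apply: eq_integral => x _; rewrite /= /law_on setIT DE//.
exact: measurable_xsection.
Qed.

Lemma independent_pair_expectation (f : T1 * T2 -> \bar R) :
  (forall A B, measurable A -> measurable B ->
    P (X @^-1` A `&` D @^-1` B) = (P (X @^-1` A) * P (D @^-1` B))%E) ->
  measurable_fun [set: T1 * T2] f -> (forall p, 0 <= f p)%E ->
  (\int[P]_w f (X w, D w) =
   \int[distribution P X]_x \int[distribution P D]_y f (x, y))%E.
Proof.
move=> ind mf f0.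
transitivity (\int[distribution P XD]_p f p)%E.
  by rewrite ge0_integral_distribution.
rewrite -(fubini_tonelli1 (m1 := distribution P X) (m2 := distribution P D) f mf f0).
apply: eq_measure_integral => S mS _.
have E : distribution P XD S =
    (distribution P X \x law_on D (@measurableT _ T))%E S.
  rewrite -independent_pair_law//; first by rewrite setIT.
  by move=> A B mA mB; rewrite setIT ind.
rewrite [LHS]E /product_measure1; apply: eq_integral => x _.
by rewrite /= /law_on setIT.
Qed.

End IndependentPair.

(** * The Euler chain of Brownian motion *)

Section BrownianChain.
Context (R : realType) (d : measure_display) (T : measurableType d)
  (P : probability T R) (B : R -> {RV P >-> R}).
Hypothesis hB : brownian_motion B.
Variables (h rho omega y sg : R) (N : nat).
Hypotheses (h0 : 0 < h) (rho0 : 0 < rho) (omega0 : 0 < omega).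

Definition increment (i : nat) (w : T) := B (i.+1%:R * h) w - B (i%:R * h) w.

Lemma measurable_increment i : measurable_fun [set: T] (increment i).
Proof. by apply: measurable_funB; exact: measurable_funP. Qed.

Definition increment_rv i : {mfun T >-> R} :=
  mfun_Sub (mem_set (measurable_increment i)).

(** Step [k] consumes increment [N - k.+1]: the increments are read backwards in
  time, so what remains to be used is always an initial segment of them. *)
Definition reversed_chain (k : nat) (w : T) :=
  euler_chain h rho omega y (fun k => sg * increment (N - k.+1) w) k.

Lemma measurable_euler_step : measurable_fun [set: R * R]
  (fun p => euler_step h rho omega p.1 (sg * p.2)).
Proof.
(* above [rho] the denominator can be cut off away from zero *)
pose g x := h / (2 * (Num.max x rho + 2 * omega)).
have -> : (fun p => euler_step h rho omega p.1 (sg * p.2)) =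
    (fun p => if p.1 < rho then p.1 else p.1 + sg * p.2 + g p.1).
  apply/funext => p; rewrite /euler_step /g.
  by case: ltP.
have mg : measurable_fun [set: R] g.
  apply: continuous_measurable_fun => x; apply: cvgM; first exact: cvg_cst.
  apply: cvgV.
    rewrite mulf_neq0// gt_eqF// ltr_pwDl ?lt_max ?rho0 ?orbT//.
    by rewrite mulr_ge0// ltW.
  apply: cvgM; first exact: cvg_cst.
  by apply: cvgD; [exact: cvg_maxr|exact: cvg_cst].
apply: measurable_fun_ifT => //; first exact: measurable_fun_ltr.
apply: measurable_funD; last exact: measurableT_comp.
by apply: measurable_funD => //; apply: measurable_funM.
Qed.

Lemma measurable_reversed_chain k : measurable_fun [set: T] (reversed_chain k).
Proof.
elim: k => [|k IHk]; first exact: measurable_cst.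
have := measurableT_comp measurable_euler_step
  (measurable_fun_pair IHk (measurable_increment (N - k.+1))).
by [].
Qed.

Definition reversed_chain_rv k : {mfun T >-> R} :=
  mfun_Sub (mem_set (measurable_reversed_chain k)).

Definition past_event (n : nat) (A : nat -> set R) :=
  \bigcap_(i in [set: 'I_n]) (increment i @^-1` A i).

Lemma increment_measurable_set i A : measurable A -> measurable (increment i @^-1` A).
Proof. by move=> mA; exact: (measurable_funPTI (increment_rv i)). Qed.

Lemma measurable_past_event n A : (forall i, measurable (A i)) ->
  measurable (past_event n A).
Proof.
move=> mA; apply: fin_bigcap_measurable => // i _.
exact: increment_measurable_set.
Qed.

Lemma past_event_prob n A : (forall i, measurable (A i)) ->
  P (past_event n A) = (\prod_(i < n) P (increment i @^-1` A i))%E.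
Proof.
move=> mA.
have t0 : 0 <= (fun i : nat => i%:R * h) 0%N by rewrite mul0r.
have tS (i : nat) : i%:R * h <= i.+1%:R * h by rewrite ler_pM2r// ler_nat.
exact: (bm_independent hB t0 tS (fun i : 'I_n => mA i)).
Qed.

Lemma past_eventS n A : past_event n.+1 A = increment n @^-1` A n `&` past_event n A.
Proof.
apply/seteqP; split=> w.
  move=> Aw; split; first exact: (Aw ord_max).
  by move=> i _; exact: (Aw (widen_ord (leqnSn n) i)).
move=> [An Aw] i _; have [iE|] := eqVneq (i : nat) n; first by rewrite /= iE.
move=> ni; have iltn : (i < n)%N by rewrite ltn_neqAle ni -ltnS ltn_ord.
exact: (Aw (Ordinal iltn)).
Qed.

Lemma past_event_ext n A A' : (forall i, (i < n)%N -> A i = A' i) ->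
  past_event n A = past_event n A'.
Proof.
by move=> AA; apply/seteqP; split=> w Aw i I; have := Aw i I; rewrite /= AA.
Qed.

Lemma past_eventT n : past_event n (fun=> setT) = setT.
Proof. by apply/seteqP; split. Qed.

(** The chain after [k] steps has used the [k] last increments only. *)
Lemma reversed_chain_independent k : (k <= N)%N ->
  forall A E, measurable A -> (forall i, measurable (E i)) ->
  P (reversed_chain k @^-1` A `&` past_event (N - k) E) =
  (P (reversed_chain k @^-1` A) * P (past_event (N - k) E))%E.
Proof.
elim: k => [|k IHk] kN A E mA mE.
  have [yA|yA] := pselect (A y).
    rewrite (_ : reversed_chain 0 @^-1` A = setT).
      by rewrite setTI probability_setT mul1e.
    by apply/seteqP; split.
  rewrite (_ : reversed_chain 0 @^-1` A = set0).
    by rewrite set0I measure0 mul0e.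
  by apply/seteqP; split.
have {}IHk := IHk (ltnW kN).
set n := (N - k.+1)%N; have nE : (N - k = n.+1)%N by rewrite /n subnSK.
rewrite nE in IHk.
have step : reversed_chain k.+1 @^-1` A =
    (fun w => (reversed_chain_rv k w, increment_rv n w)) @^-1`
      ((fun p => euler_step h rho omega p.1 (sg * p.2)) @^-1` A) by [].
have mS : measurable ((fun p => euler_step h rho omega p.1 (sg * p.2)) @^-1` A).
  by rewrite -[X in measurable X]setTI; exact: measurable_euler_step.
have mpe := measurable_past_event n mE.
have ind A1 B1 E1 : measurable A1 -> measurable B1 -> (forall i, measurable (E1 i)) ->
    P (reversed_chain k @^-1` A1 `&` (increment n @^-1` B1 `&` past_event n E1)) =
    (P (reversed_chain k @^-1` A1) * (P (increment n @^-1` B1) * P (past_event n E1)))%E.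
  move=> mA1 mB1 mE1.
  pose E2 i := if i == n then B1 else E1 i.
  have mE2 i : measurable (E2 i) by rewrite /E2; case: eqP.
  have E21 : past_event n E2 = past_event n E1.
    by apply: past_event_ext => i; rewrite ltn_neqAle /E2 => /andP[/negbTE ->].
  have E2n : E2 n = B1 by rewrite /E2 eqxx.
  have := IHk _ _ mA1 mE2.
  rewrite past_eventS E21 E2n => ->; congr (_ * _)%E.
  have := past_event_prob n.+1 mE2; rewrite past_eventS E21 E2n => ->.
  by rewrite big_ord_recr/= E2n -(past_event_prob n mE2) E21 muleC.
rewrite step; apply: (independent_pair_event (P := P) mpe) => //.
  by move=> A1 B1 mA1 mB1; exact: ind.
move=> A1 B1 mA1 mB1.
have := ind A1 B1 (fun=> setT) mA1 mB1 (fun=> measurableT).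
by rewrite past_eventT setIT probability_setT mule1.
Qed.

Lemma reversed_chain_next_independent k : (k < N)%N ->
  forall A1 B1, measurable A1 -> measurable B1 ->
  P (reversed_chain k @^-1` A1 `&` increment (N - k.+1) @^-1` B1) =
  (P (reversed_chain k @^-1` A1) * P (increment (N - k.+1) @^-1` B1))%E.
Proof.
move=> kN A1 B1 mA1 mB1; set n := (N - k.+1)%N.
have nE : (N - k = n.+1)%N by rewrite /n subnSK.
pose E i := if i == n then B1 else setT.
have mE i : measurable (E i) by rewrite /E; case: eqP.
have := reversed_chain_independent (ltnW kN) mA1 mE.
rewrite nE past_eventS.
have -> : past_event n E = setT.
  rewrite -(past_eventT n); apply: past_event_ext => i.
  by rewrite ltn_neqAle /E => /andP[/negbTE ->].
by rewrite setIT /E eqxx.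
Qed.

Lemma increment_normal n A : measurable A ->
  P (increment n @^-1` A) = normal_prob 0 (Num.sqrt h) A.
Proof.
move=> mA.
have s0 : 0 <= n%:R * h by rewrite mulr_ge0// ltW.
have st : n%:R * h < n.+1%:R * h by rewrite ltr_pM2r// ltr_nat.
have := bm_gaussian hB s0 st mA.
by have -> : n.+1%:R * h - n%:R * h = h by rewrite -natr1; ring.
Qed.

Hypothesis rho1 : rho <= 1.
Hypothesis step_le : forall x, (\int[normal_prob 0 (Num.sqrt h)]_xi
  (lyapunov rho (euler_step h rho omega x (sg * xi)))%:E <=
  (lyapunov rho x + 4 * h)%:E)%E.

Let lyapunov_pos x : 0 <= lyapunov rho x.
Proof. by apply: lyapunov_ge0 => //; apply: le_trans rho1 _; lra. Qed.

Lemma reversed_chain_lyapunov k : (k <= N)%N ->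
  (\int[P]_w (lyapunov rho (reversed_chain k w))%:E <=
   (lyapunov rho y + 4 * (k%:R * h))%:E)%E.
Proof.
elim: k => [|k IHk] kN.
  by rewrite /reversed_chain/= integral_cst// [X in (_ * X)%E](probability_setT P) mule1 mul0r mulr0 addr0.
set n := (N - k.+1)%N.
pose f (p : R * R) := (lyapunov rho (euler_step h rho omega p.1 (sg * p.2)))%:E.
have mf : measurable_fun [set: R * R] f.
  apply/measurable_EFinP; apply: measurableT_comp; first exact: measurable_lyapunov.
  exact: measurable_euler_step.
have f0 p : (0 <= f p)%E by rewrite lee_fin.
have -> : (\int[P]_w (lyapunov rho (reversed_chain k.+1 w))%:E =
    \int[P]_w f (reversed_chain_rv k w, increment_rv n w))%E by [].
rewrite (@independent_pair_expectation _ _ _ P _ _ _ _ (reversed_chain_rv k)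
  (increment_rv n))//; last exact: reversed_chain_next_independent.
apply: (@le_trans _ _ (\int[distribution P (reversed_chain_rv k)]_x
   (lyapunov rho x + 4 * h)%:E)%E).
  apply: ge0_le_integral => //.
  - by move=> x _; exact: integral_ge0.
  - exact: (@measurable_fun_fubini_tonelli_F _ _ _ _ _
      (distribution P (increment_rv n)) f mf f0).
  - apply/measurable_EFinP; apply: measurable_funD => //; exact: measurable_lyapunov.
  - move=> x _; apply: le_trans (step_le x).
    rewrite le_eqVlt; apply/orP; left; apply/eqP.
    transitivity (\int[normal_prob 0 (Num.sqrt h)]_y f (x, y))%E; last by [].
    pose idf : measurableTypeR R -> R := fun r => r.
    have mid : measurable_fun [set: measurableTypeR R] idf.
      by move=> _ A mA; rewrite setTI.
    pose idR : {mfun measurableTypeR R >-> R} := mfun_Sub (mem_set mid).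
    transitivity (\int[distribution (normal_prob 0 (Num.sqrt h)) idR]_y f (x, y))%E.
      by apply: eq_measure_integral => A mA _; exact: increment_normal.
    rewrite ge0_integral_distribution//.
    exact: (measurableT_comp mf (measurable_pair1 x)).
have ml : measurable_fun [set: R] (fun x => (lyapunov rho x + 4 * h)%:E).
  apply/measurable_EFinP; apply: measurable_funD => //; exact: measurable_lyapunov.
rewrite ge0_integral_distribution//; last first.
  by move=> x; rewrite lee_fin addr_ge0// mulr_ge0// ltW.
have ml' : measurable_fun [set: T] (fun w => (lyapunov rho (reversed_chain k w))%:E).
  apply/measurable_EFinP; apply: measurableT_comp; first exact: measurable_lyapunov.
  exact: measurable_reversed_chain.
under eq_integral do rewrite /= EFinD.
rewrite ge0_integralD//; last 2 first.
- by move=> w _; rewrite lee_fin.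
- by move=> w _; rewrite lee_fin mulr_ge0// ltW.
rewrite integral_cst// [X in (_ + _ * X)%E](probability_setT P) mule1.
apply: (le_trans (leeD2r _ (IHk (ltnW kN)))).
by rewrite -EFinD lee_fin -natr1; lra.
Qed.

(** Markov's inequality for the Lyapunov function, which is at least [- ln rho]
  on the event that the chain is frozen. *)
Lemma reversed_chain_frozen_prob : rho < 1 ->
  (P (reversed_chain N @^-1` [set x : R | (x < rho)%R]) <=
   ((lyapunov rho y + 4 * (N%:R * h)) / - ln rho)%:E)%E.
Proof.
move=> rho_lt1; have lr : 0 < - ln rho by rewrite oppr_gt0 ln_lt0// rho0.
set A := _ @^-1` _.
have mA : measurable A.
  have := measurable_funPTI (reversed_chain_rv N) (measurable_itv `]-oo, rho[).
  by rewrite /A; congr measurable; apply/seteqP; split => w; rewrite /= in_itv.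
have ml' : measurable_fun [set: T] (fun w => (lyapunov rho (reversed_chain N w))%:E).
  apply/measurable_EFinP; apply: measurableT_comp; first exact: measurable_lyapunov.
  exact: measurable_reversed_chain.
have lA : (((- ln rho)%:E * P A) <= (lyapunov rho y + 4 * (N%:R * h))%:E)%E.
  apply: le_trans (reversed_chain_lyapunov (leqnn N)).
  rewrite -integral_cst//.
  apply: (@le_trans _ _ (\int[P]_(w in A) (lyapunov rho (reversed_chain N w))%:E)%E).
    apply: ge0_le_integral => //.
    - by move=> w _; rewrite lee_fin ltW.
    - exact: measurable_funTS.
    move=> w Aw; rewrite lee_fin /lyapunov.
    have x2 : 0 <= reversed_chain N w ^+ 2 by exact: sqr_ge0.
    have : ln (Num.max (reversed_chain N w) (rho / 2)) <= ln rho.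
      have r2 : 0 < rho / 2 by rewrite divr_gt0.
      rewrite ler_ln ?posrE//; last by rewrite lt_max r2 orbT.
      by rewrite ge_max (ltW Aw)/=; lra.
    lra.
  by apply: ge0_subset_integral => // w _; rewrite lee_fin.
have PA : P A \is a fin_num by exact: fin_num_measure.
move: lA; rewrite -(fineK PA) -EFinM !lee_fin => lA.
by rewrite ler_pdivlMr// mulrC.
Qed.

End BrownianChain.

(** * Almost sure repulsion *)

Section AlmostSureRepulsion.
Context (R : realType) (d : measure_display) (T : measurableType d)
  (P : probability T R) (B : R -> {RV P >-> R}).
Hypothesis hB : brownian_motion B.

Lemma mesh_small (T1 e : R) : 0 < T1 -> 0 < e ->
  exists n, forall N, (n <= N)%N -> T1 / N.+1%:R <= e.
Proof.
move=> T0 e0; exists (Num.truncn (T1 / e)) => N nN.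
have := truncnS_gt (T1 / e); rewrite ltr_pdivrMr// => h.
rewrite ler_pdivrMr// mulrC; apply: le_trans (ltW h) _.
by rewrite ler_pM2r// ler_nat ltnS.
Qed.

Section FixedTime.
Variables (sg T1 y C : R).
Hypotheses (sg2 : sg ^+ 2 = 1) (T0 : 0 < T1) (y0 : 0 < y).

Let rho (j : nat) : R := expR (- j.+1%:R).
Let rho_gt0 j : 0 < rho j. Proof. exact: expR_gt0. Qed.
Let rho_lt1 j : rho j < 1.
Proof. by rewrite /rho expR_lt1 oppr_lt0. Qed.
Let omega j : R := rho j ^+ 3 / 2.
Let omega_gt0 j : 0 < omega j.
Proof. by rewrite divr_gt0// exprn_gt0. Qed.

Let chain j N := reversed_chain B (T1 / N.+1%:R) (rho j) (omega j) y sg N.+1 N.+1.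
Let frozen j N := chain j N @^-1` [set x : R | x < rho j].
Let frozen_ult j := \bigcup_n \bigcap_(N in [set N | (n <= N)%N]) frozen j N.

Let mesh_gt0 N : 0 < T1 / N.+1%:R. Proof. by rewrite divr_gt0. Qed.

Let frozen_measurable j N : measurable (frozen j N).
Proof.
have := measurable_funPTI (reversed_chain_rv B (T1 / N.+1%:R) y sg N.+1
  (rho_gt0 j) (omega_gt0 j) N.+1) (measurable_itv `]-oo, rho j[).
by rewrite /frozen; congr measurable; apply/seteqP; split => w; rewrite /= in_itv.
Qed.

Let M := y ^+ 2 - ln y + 4 * T1.

Let frozen_prob j : exists n, forall N, (n <= N)%N ->
  (P (frozen j N) <= (M / j.+1%:R)%:E)%E.
Proof.
have [h0 h00 step] := euler_step_lyapunov (rho_gt0 j) (ltW (rho_lt1 j)).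
have [n hn] := mesh_small T0 h00.
exists n => N nN.
apply: le_trans (reversed_chain_frozen_prob hB y N.+1 (mesh_gt0 N)
  (rho_gt0 j) (omega_gt0 j) (ltW (rho_lt1 j)) _ (rho_lt1 j)) _.
  by move=> x; apply: step => //; exact: hn.
rewrite lee_fin /rho expRK opprK ler_pM2r ?invr_gt0//.
have -> : N.+1%:R * (T1 / N.+1%:R) = T1 by rewrite mulrC divfK ?pnatr_eq0.
rewrite /M lerD2r /lyapunov lerD2l lerN2.
by rewrite ler_ln ?posrE// ?lt_max ?y0// le_max lexx.
Qed.

Let frozen_ult_measurable j : measurable (frozen_ult j).
Proof.
apply: bigcup_measurable => n _; apply: bigcap_measurable => //.
by exists n => /=.
Qed.

Let frozen_ult_prob j : (P (frozen_ult j) <= (M / j.+1%:R)%:E)%E.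
Proof.
pose F n := \bigcap_(N in [set N | (n <= N)%N]) frozen j N.
have mF n : measurable (F n).
  by apply: bigcap_measurable => //; exists n => /=.
have ndF : nondecreasing_seq F.
  move=> n m nm; apply/subsetPset => w Fw N /= mN.
  by apply: Fw => /=; exact: leq_trans mN.
have cvF := nondecreasing_cvg_mu (mu := P) mF (bigcupT_measurable F mF) ndF.
apply: (cvge_to_le cvF); apply: nearW => n /=.
have [m hm] := frozen_prob j.
apply: le_trans (hm (maxn n m) (leq_maxr _ _)).
by apply: le_measure; rewrite ?inE//; apply: bigcap_inf; rewrite /= leq_maxl.
Qed.

Let path w (t : R) := - sg * B t w.

Let not_frozen_stays_away w j : {within [set t | 0 <= t], continuous (path w)} ->
  ~ frozen_ult j w -> stays_away (path w) T1 y C.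
Proof.
move=> cb nf; exists (rho j / 2); first by rewrite divr_gt0.
have [dl dl0 hdl] := segment_unif_continuous
  (@within_ray_segment _ _ 0 T1 (lexx 0) cb) (omega_gt0 j).
have C0 : 0 < `|C| + 1 by rewrite ltr_wpDl.
pose e := Num.min (dl / 2)
  (Num.min (rho j * omega j / 2 / (`|C| + 1)) (2 * rho j ^+ 2)).
have e0 : 0 < e.
  by rewrite !lt_min; apply/and3P; split;
    rewrite ?divr_gt0 ?mulr_gt0 ?exprn_gt0.
have [n hn] := mesh_small T0 e0.
have [N nN fN] : exists2 N, (n <= N)%N & ~ frozen j N w.
  apply: contrapT => /forall2NP h; apply: nf; exists n => // N /= nN.
  by apply: contrapT => fN; case: (h N).
have := hn _ nN; rewrite !le_min => /andP[h1 /andP[h2 h3]].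
have orho : omega j <= rho j / 2.
  rewrite /omega ler_pM2r ?invr_gt0// -[leRHS]mulr1 exprS ler_pM2l//.
  by rewrite exprn_ile1// ltW.
have Ch : C * (T1 / N.+1%:R) <= rho j * omega j / 2.
  apply: (@le_trans _ _ ((`|C| + 1) * (T1 / N.+1%:R))).
    by rewrite ler_pM2r// (le_trans (ler_norm _))// lerDl.
  by rewrite mulrC -ler_pdivlMr.
move=> c x z cC pz yz.
apply: (euler_chain_comparison T0 (ltn0Sn N) (rho_gt0 j) (omega_gt0 j) orho Ch h3
  _ cC pz yz).
  move=> u v uT vT uv; rewrite ltW// hdl//.
  by apply: le_lt_trans (le_trans uv h1) _; rewrite ltr_pdivrMr// ltr_pMr// ltr1n.
rewrite leNgt; apply/negP => fr; apply: fN.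
rewrite /frozen /chain /reversed_chain.
have -> : (fun w => euler_chain (T1 / N.+1%:R) (rho j) (omega j) y (fun k =>
     sg * increment B (T1 / N.+1%:R) (N.+1 - k.+1) w) N.+1) =
    (fun w => euler_chain (T1 / N.+1%:R) (rho j) (omega j) y (fun k =>
      - (path w ((N.+1 - k.+1).+1%:R * (T1 / N.+1%:R)) -
         path w ((N.+1 - k.+1)%:R * (T1 / N.+1%:R)))) N.+1).
  apply/funext => w'; congr euler_chain; apply/funext => k.
  by rewrite /increment /path; ring.
exact: fr.
Qed.

(** A continuous path outside [frozen_ult j] has arbitrarily fine meshes on which
  the chain is not frozen, so that the comparison applies to it. The
  intersection of the [frozen_ult j] is null, since [frozen_ult j] has
  probability at most [M / j.+1]. *)
Lemma ae_stays_away :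
  {ae P, forall w, stays_away (fun t => - sg * B t w) T1 y C}.
Proof.
have [A [mA A0 subA]] := bm_continuous hB.
exists (A `|` \bigcap_j frozen_ult j); split.
- by apply: measurableU => //; apply: bigcapT_measurable.
- apply/eqP; rewrite eq_le measure_ge0 andbT.
  apply: le_trans (measureU2 _ _ _) _ => //; first exact: bigcapT_measurable.
  rewrite [X in (X + _)%E]A0 add0e.
  have Mle j : (P (\bigcap_j frozen_ult j) <= (M / j.+1%:R)%:E)%E.
    apply: le_trans (frozen_ult_prob j).
    apply: le_measure; rewrite ?inE//; first exact: bigcapT_measurable.
    exact: bigcap_inf.
  have fP : P (\bigcap_j frozen_ult j) \is a fin_num.
    by apply: fin_num_measure; exact: bigcapT_measurable.
  apply: (@le_trans _ _ (fine (P (\bigcap_j frozen_ult j)))%:E).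
    by rewrite fineK.
  rewrite lee_fin; apply/ler_addgt0Pr => e e0; rewrite add0r.
  have [n _ hn] : exists2 n, True & `|M| / n.+1%:R <= e.
    have M1 : 0 < `|M| + 1 by rewrite ltr_wpDl.
    have [n hn] := mesh_small M1 e0; exists n => //.
    by apply: le_trans (hn n (leqnn n)); rewrite ler_pM2r ?invr_gt0// lerDl.
  apply: le_trans hn; rewrite -lee_fin fineK//; apply: le_trans (Mle n) _.
  by rewrite lee_fin ler_pM2r ?invr_gt0// ler_norm.
move=> w /= ns; have [Aw|Aw] := pselect (A w); first by left.
right=> j _; apply: contrapT => nf; apply: ns.
apply: not_frozen_stays_away nf.
have : {within [set t | 0 <= t], continuous (fun t => B t w)}.
  by apply: contrapT => nc; apply: Aw; exact: subA.
move=> /subspace_continuousP cw; apply/subspace_continuousP => t t0.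
by apply: cvgM; [exact: cvg_cst|exact: cw].
Qed.

End FixedTime.

Lemma ae_repelling sg : sg ^+ 2 = 1 ->
  {ae P, forall w, repelling (fun t => - sg * B t w)}.
Proof.
move=> sg2; apply: ae_foralln => i; apply: ae_foralln => j.
apply: ae_foralln => k; apply: ae_foralln => l.
by apply: ae_stays_away => //; rewrite ?divr_gt0// ?invr_gt0.
Qed.

End AlmostSureRepulsion.

Unset Implicit Arguments.

Theorem theorem1p1 (R : realType) (d : measure_display) (T : measurableType d)
    (P : probability T R) (B : R -> {RV P >-> R}) (hB : brownian_motion B) :
  {ae P, forall w : T,
    {within [set p : R * R | p.2 <= 0],
      continuous (fun p : R * R => zeta (fun t => B t w) p.2 p.1)}}.
Proof.
have rep := ae_repelling hB (sg := -1) (ltac:(by rewrite sqrrN expr1n)).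
have repN := ae_repelling hB (sg := 1) (expr1n _ _).
apply: filterS (filterI (filterI (bm_start hB) (bm_continuous hB))
  (filterI rep repN)) => w [[B0 cB] [r rN]].
apply: zeta_continuous => //.
- by rewrite (_ : (fun t => B t w) = (fun t => - -1 * B t w))//;
    apply/funext => t; rewrite opprK mul1r.
- by rewrite (_ : (fun t => - B t w) = (fun t => - 1 * B t w))//;
    apply/funext => t; rewrite mulN1r.
Qed.
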